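(* Let $m\ge 2$ and let $p_1,\ldots,p_m\in[1,\infty]$ be such that $\frac12\le \frac1{p_1}+\cdots+\frac1{p_m}<1$. Put $$k_0:=\max\left\{t\in\{1,\ldots,m\}:\ \frac1{p_t}+\cdots+\frac1{p_m}\ge\frac12\right\}$$ and $$s_k=\begin{cases}\left[1-\left(\frac1{p_k}+\cdots+\frac1{p_m}\right)\right]^{-1}, & \text{if } k\le k_0,\\ 2, & \text{if } k>k_0.\end{cases}$$ Then there is a constant $C_m$, depending only on $m$, such that $$\left(\sum_{j_1=1}^n\left(\cdots\left(\sum_{j_m=1}^n|A(e_{j_1},\ldots,e_{j_m})|^{s_m}\right)^{\frac{s_{m-1}}{s_m}}\cdots\right)^{\frac{s_1}{s_2}}\right)^{\frac1{s_1}}\le C_m\|A\|$$ for all positive integers $n$ and all $m$-linear forms $A\colon \ell_{p_1}^n\times\cdots\times\ell_{p_m}^n\to\mathbb K$. Moreover: (i) the exponents $s_1,\ldots,s_{k_0}$ are optimal; (ii) if $p_{k_0}\ge 2$, the $m$-tuple of exponents $(s_1,\ldots,s_m)$ is globally sharp.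
   Context: $\mathbb K=\mathbb R$ or $\mathbb C$; $\ell_p^n$ is $\mathbb K^n$ with the $\ell_p$ norm; $e_j$ are the canonical unit vectors; $1/\infty=0$. For an $m$-linear form $A\colon\ell_{p_1}^n\times\cdots\times\ell_{p_m}^n\to\mathbb K$, $\|A\|:=\sup\{|A(z^{(1)},\ldots,z^{(m)})|:\ \|z^{(j)}\|_{\ell_{p_j}^n}\le 1,\ j=1,\ldots,m\}$. For fixed $p_1,\ldots,p_m$, call $(t_1,\ldots,t_m)\in(0,\infty)^m$ admissible if there is a constant $C$ (not depending on $n$ or $A$) such that $$\left(\sum_{j_1=1}^n\left(\cdots\left(\sum_{j_m=1}^n|A(e_{j_1},\ldots,e_{j_m})|^{t_m}\right)^{\frac{t_{m-1}}{t_m}}\cdots\right)^{\frac{t_1}{t_2}}\right)^{\frac1{t_1}}\le C\|A\|$$ for all positive integers $n$ and all $m$-linear forms $A\colon\ell_{p_1}^n\times\cdots\times\ell_{p_m}^n\to\mathbb K$. The exponent $s_k$ at position $k$ is optimal if every admissible $(t_1,\ldots,t_m)$ satisfies $t_k\ge s_k$. An $m$-tuple $(t_1,\ldots,t_m)$ is globally sharp if it is admissible and, for every $j\in\{1,\ldots,m\}$ and every $0<\varepsilon_j<t_j$, the $m$-tuple $(t_1,\ldots,t_{j-1},t_j-\varepsilon_j,t_{j+1},\ldots,t_m)$ is not admissible. *)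

(* Defs.v *)
From mathcomp Require Import all_boot all_order all_algebra.
From mathcomp Require Import complex.
From mathcomp Require Import all_classical all_reals all_analysis.

Set Implicit Arguments.
Unset Strict Implicit.
Unset Printing Implicit Defensive.
Import Order.TTheory GRing.Theory Num.Theory.
Local Open Scope classical_set_scope.
Local Open Scope ring_scope.

Inductive scalar_kind := RealScalars | ComplexScalars.

Definition scalars (R : realType) (s : scalar_kind) : numFieldType :=
  match s with RealScalars => R | ComplexScalars => R[i] end.

Definition modulus (R : realType) (s : scalar_kind) : scalars R s -> R :=
  match s with
  | RealScalars => fun x : R => `|x|
  | ComplexScalars => @Normc.normc R
  end.

Definition lp_norm (R : realType) (s : scalar_kind) (p : \bar R) (n : nat)
    (z : 'rV[scalars R s]_n) : R :=
  match p with
  | r%:E => (\sum_(i < n) modulus (z ord0 i) `^ r) `^ r^-1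
  | _ => \big[Num.max/0]_(i < n) modulus (z ord0 i)
  end.

Definition multilinear (K : fieldType) (m n : nat)
    (A : ('I_m -> 'rV[K]_n) -> K) : Prop :=
  forall (z : 'I_m -> 'rV[K]_n) (i : 'I_m),
    scalar (fun x : 'rV[K]_n => A (@dfwith 'I_m (fun=> 'rV[K]_n) z i x)).

(* Real-valued [sup]: a multilinear form on finite-dimensional spaces is
   bounded on the product of the unit balls, so this is the true supremum. *)
Definition form_norm (R : realType) (s : scalar_kind) (m n : nat)
    (p : 'I_m -> \bar R)
    (A : ('I_m -> 'rV[scalars R s]_n) -> scalars R s) : R :=
  sup [set modulus (A z) | z in
        [set z : 'I_m -> 'rV[scalars R s]_n | forall k, lp_norm (p k) (z k) <= 1]].

Definition form_coef (K : fieldType) (m n : nat)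
    (A : ('I_m -> 'rV[K]_n) -> K) (j : m.-tuple 'I_n) : K :=
  A (fun k => delta_mx ord0 (tnth j k)).

(* [nested_sum r t a] is
   (\sum_(j1) (... (\sum_(jm) a(j1,...,jm)^tm)^(t(m-1)/tm) ...)^(t1/t2))^(r/t1). *)
Fixpoint nested_sum (R : realType) (m n : nat) (r : R) {struct m} :
    ('I_m -> R) -> (m.-tuple 'I_n -> R) -> R :=
  match m with
  | 0 => fun _ a => a [tuple] `^ r
  | m'.+1 => fun t a =>
      (\sum_(j < n) nested_sum (t ord0) (fun k : 'I_m' => t (lift ord0 k))
                      (fun js : m'.-tuple 'I_n => a [tuple of j :: js]))
        `^ (r / t ord0)
  end.

Definition mixed_norm (R : realType) (s : scalar_kind) (m n : nat)
    (t : 'I_m -> R) (A : ('I_m -> 'rV[scalars R s]_n) -> scalars R s) : R :=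
  nested_sum 1 t (fun j => modulus (form_coef A j)).

Definition admissible (R : realType) (s : scalar_kind) (m : nat)
    (p : 'I_m -> \bar R) (t : 'I_m -> R) : Prop :=
  (forall k, 0 < t k) /\
  exists C : R, forall (n : nat)
    (A : ('I_m -> 'rV[scalars R s]_n) -> scalars R s),
    (0 < n)%N -> multilinear A -> mixed_norm t A <= C * form_norm p A.

Definition optimal (R : realType) (s : scalar_kind) (m : nat)
    (p : 'I_m -> \bar R) (k : 'I_m) (sk : R) : Prop :=
  forall t : 'I_m -> R, admissible s p t -> sk <= t k.

Definition globally_sharp (R : realType) (s : scalar_kind) (m : nat)
    (p : 'I_m -> \bar R) (t : 'I_m -> R) : Prop :=
  admissible s p t /\
  forall (j : 'I_m) (eps : R), 0 < eps -> eps < t j ->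
    ~ admissible s p (@dfwith 'I_m (fun=> R) t j (t j - eps)).

(* [1/p_k + ... + 1/p_m]; positions are numbered from 0. The extended-real
   inverse satisfies [+oo^-1 = 0]. *)
Definition inv_tail (R : realType) (m : nat) (p : 'I_m -> \bar R) (k : nat) : R :=
  \sum_(i < m | (k <= i)%N) fine (p i)^-1%E.

(* The index set of the maximum contains position 0, hence is nonempty, as soon
   as [0 < m] and [1/2 <= inv_tail p 0]; the default value 0 is then unused. *)
Definition k0 (R : realType) (m : nat) (p : 'I_m -> \bar R) : nat :=
  (\max_(t < m | (2^-1 <= inv_tail p t)%R) t)%N.

Definition exponents (R : realType) (m : nat) (p : 'I_m -> \bar R)
    (k : 'I_m) : R :=
  if (k <= k0 p)%N then (1 - inv_tail p k)^-1 else 2.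

(* Main.v *)
Require Import Defs.
From mathcomp Require Import all_boot all_order all_algebra.
From mathcomp Require Import complex ring lra.
From mathcomp Require Import all_classical all_reals all_analysis.
Import Order.TTheory GRing.Theory Num.Theory.
Local Open Scope ring_scope.

(** Write [r_k = 1/p_k] and [lam_k = r_k + r_(k+1) + ...] for the tail sums, and
    identify a form with its coefficient tensor.

    The inequality. While [lam_2 >= 1/2], the first variable is peeled off: with
    this variable frozen the inequality holds by induction, so that the form
    becomes an operator from [l_(p_1)] to a mixed-norm space all of whose
    exponents lie between [2] and [q = 1 / (1 - lam_2)]. Such a space has cotype
    [q] with constant one ([cotype]), and the best multiplier of the unit vectors
    turns [1/q] into [1/q - r_1 = 1 - lam_1] ([exponent_step]). Once
    [lam_2 < 1/2], all exponents but the first, [s = 1 / (1 - lam_1)], are [2],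
    and [core_bound] applies. Khinchin's inequality gives, for vectors [x_l] in
    the balls, one bound per position [k] on the sum over [i] of the [l_2] norms
    of the rescaled slices [j_k = i] ([littlewood]). Let [mu] be the probability
    on multi-indices that the extremal problem suggests, with marginals [q_l],
    and take [x_l = q_l `^ r_l]. Then the squared rescaled coefficients are
    proportional to [mu * G] with [G] a weighted geometric mean of the marginals;
    this needs [lam_2 <= 1/2]. By Cauchy-Schwarz the [k]-th sum dominates the
    mean of the square root of [G / q_k], and since [G] is at least the smallest
    [q_k], these means add up to at least one. No interpolation is involved and
    the constant is [m * 2 ^ m], whatever the [p_k].

    Optimality. Freezing variables reduces any position to the first one
    ([admissible_behead]). The diagonal form with all indices equal has norm
    [n `^ (1 - lam_1)] and mixed norm [n `^ (1/t_1)], which gives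
    [1/t_1 <= 1 - lam_1] ([first_exponent_necessary]).

    Sharpness. If all [p_k >= 2], some tensor of signs has norm
    [n `^ (1/2 + \sum_k (1/2 - r_k))] up to powers of [ln n], whence
    [\sum_k 1/t_k <= 1/2 + \sum_k (1/2 - r_k)] ([sum_exponents_necessary]). A
    union bound makes the signs small on the vectors with entries in [{-1, 0, 1}]
    ([exists_small_signs]); a functional that is small on these is in weak [l_2],
    hence in [l_2] up to a logarithm ([flat_to_l2]). Applied to the variables from
    position [k0] on, this is an equality for the exponents of the theorem, so
    that none of the exponents [2] can be lowered. *)

Set Implicit Arguments.
Unset Strict Implicit.
Unset Printing Implicit Defensive.

(** * Scalars: both fields as a real plane with a multiplicative modulus *)

Section Scalars.
Variables (R : realType) (s : scalar_kind).
Notation K := (scalars R s).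

Definition real_scalar (x : R) : K :=
  match s return scalars R s with
  | RealScalars => x
  | ComplexScalars => (real_complex R) x
  end.

(** Both fields become real planes, the second coordinate of a real scalar being
    zero, so that Khinchin's inequality is needed for real Hilbert spaces only. *)
Definition coord (b : bool) : K -> R :=
  match s return scalars R s -> R with
  | RealScalars => fun x => if b then x else 0
  | ComplexScalars => fun x => if b then complex.Re x else complex.Im x
  end.

Lemma real_scalarD x y : real_scalar (x + y) = real_scalar x + real_scalar y.
Proof. by rewrite /real_scalar; case: s => //; rewrite rmorphD. Qed.

Lemma real_scalarM x y : real_scalar (x * y) = real_scalar x * real_scalar y.
Proof. by rewrite /real_scalar; case: s => //; rewrite rmorphM. Qed.

Lemma real_scalar0 : real_scalar 0 = 0.
Proof. by rewrite /real_scalar; case: s. Qed.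

Lemma real_scalar1 : real_scalar 1 = 1.
Proof. by rewrite /real_scalar; case: s. Qed.

Lemma real_scalar_sum (I : finType) (F : I -> R) :
  real_scalar (\sum_i F i) = \sum_i real_scalar (F i).
Proof. exact: (big_morph _ real_scalarD real_scalar0). Qed.

Lemma coordD b x y : coord b (x + y) = coord b x + coord b y.
Proof.
rewrite /coord; case: s x y => /= x y; first by case: b; rewrite ?addr0.
by case: x y => [? ?] [? ?]; case: b.
Qed.

Lemma coord0 b : coord b 0 = 0.
Proof. by rewrite /coord; case: s; case: b. Qed.

Lemma coord_sum b (I : finType) (F : I -> K) :
  coord b (\sum_i F i) = \sum_i coord b (F i).
Proof. exact: (big_morph _ (coordD b) (coord0 b)). Qed.

Lemma coordN b x : coord b (- x) = - coord b x.
Proof. by apply/eqP; rewrite -addr_eq0 -coordD addNr coord0. Qed.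

Lemma coord_sign b (e : bool) x : coord b ((-1) ^+ e * x) = (-1) ^+ e * coord b x.
Proof. by case: e; rewrite ?expr1 ?expr0 ?mul1r ?mulN1r ?coordN. Qed.

Lemma modulus_sq (x : K) : modulus x ^+ 2 = \sum_b coord b x ^+ 2.
Proof.
rewrite big_bool /modulus /coord; case: s x => /= [x|[a b]].
  by rewrite expr0n addr0 real_normK ?num_real.
by rewrite sqr_sqrtr ?addr_ge0 ?sqr_ge0.
Qed.

Lemma modulus_ge0 (x : K) : 0 <= modulus x.
Proof.
by rewrite /modulus; case: s x => //= -[a b] /=; rewrite sqrtr_ge0.
Qed.

Lemma modulusM (x y : K) : modulus (x * y) = modulus x * modulus y.
Proof.
rewrite /modulus; case: s x y => /= x y; first exact: normrM.
exact: Normc.normcM.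
Qed.

Lemma modulusD (x y : K) : modulus (x + y) <= modulus x + modulus y.
Proof.
rewrite /modulus; case: s x y => /= x y; first exact: ler_normD.
exact: le_normcD.
Qed.

Lemma modulus_real x : modulus (real_scalar x) = `|x|.
Proof.
rewrite /modulus /real_scalar; case: s => //=.
by rewrite expr0n addr0 sqrtr_sqr.
Qed.

Lemma modulus0 : modulus (0 : K) = 0.
Proof. by rewrite -real_scalar0 modulus_real normr0. Qed.

Lemma modulus1 : modulus (1 : K) = 1.
Proof. by rewrite -real_scalar1 modulus_real normr1. Qed.

Lemma modulus_eq0 (x : K) : modulus x = 0 -> x = 0.
Proof.
rewrite /modulus; case: s x => /= x; last exact: Normc.eq0_normc.
by move/eqP; rewrite normr_eq0 => /eqP.
Qed.

Lemma modulusN (x : K) : modulus (- x) = modulus x.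
Proof.
apply: (@pexpIrn _ 2) => //; rewrite ?nnegrE ?modulus_ge0 // !modulus_sq.
by apply: eq_bigr => b _; rewrite coordN sqrrN.
Qed.

Lemma modulus_sign (e : bool) (x : K) : modulus ((-1) ^+ e * x) = modulus x.
Proof. by case: e; rewrite ?expr1 ?expr0 ?mul1r ?mulN1r ?modulusN. Qed.

Lemma modulus_sum (I : Type) (r : seq I) (P : pred I) (F : I -> K) :
  modulus (\sum_(i <- r | P i) F i) <= \sum_(i <- r | P i) modulus (F i).
Proof.
elim/big_rec2: _ => [|i y x _ h]; first by rewrite modulus0.
by apply: le_trans (modulusD _ _) _; rewrite lerD2l.
Qed.

Lemma modulus_prod (I : finType) (F : I -> K) :
  modulus (\prod_i F i) = \prod_i modulus (F i).
Proof. exact: (big_morph _ modulusM modulus1). Qed.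


Lemma coord_le_modulus b (x : K) : `|coord b x| <= modulus x.
Proof.
rewrite -(@ler_pXn2r _ 2) ?nnegrE ?modulus_ge0 // modulus_sq real_normK ?num_real //.
by rewrite (bigD1 b) //= lerDl sumr_ge0 // => *; rewrite sqr_ge0.
Qed.

Lemma polar (x : K) : exists u, modulus u <= 1 /\ u * x = real_scalar (modulus x).
Proof.
have [->|x0] := eqVneq x 0.
  by exists 0; rewrite modulus0 ler01 mul0r real_scalar0.
exists (real_scalar (modulus x) / x); split; last by rewrite divfK.
have mx : modulus x != 0 by apply: contra_neq x0; exact: modulus_eq0.
suff -> : modulus (real_scalar (modulus x) / x) = 1 by [].
apply: (mulIf mx); rewrite mul1r -modulusM divfK // modulus_real ger0_norm //.
exact: modulus_ge0.
Qed.

End Scalars.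

(** * Finite sums: tuples, averages, weighted means *)

Section TupleSums.
Variables (T : finType) (V : nmodType).

Lemma sum_tuple0 (F : 0.-tuple T -> V) : \sum_t F t = F [tuple].
Proof.
rewrite (bigD1 [tuple]) //= big1 ?addr0 // => t; rewrite (tuple0 t).
by case/eqP.
Qed.

Lemma sum_tuple_cons m (F : m.+1.-tuple T -> V) :
  \sum_t F t = \sum_x \sum_(t : m.-tuple T) F (cons_tuple x t).
Proof.
rewrite pair_big /=.
rewrite (reindex (fun p : T * m.-tuple T => cons_tuple p.1 p.2)) //=.
exists (fun t => (thead t, behead_tuple t)).
  by move=> [x t] _ /=; congr pair; apply: val_inj.
by move=> t _; apply: val_inj => /=; rewrite {3}(tuple_eta t).
Qed.

End TupleSums.

Section Means.
Variable R : realType.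
Implicit Types I T : finType.

Lemma sum_sqr_eq0 I (u : I -> R) : \sum_i u i ^+ 2 = 0 -> forall i, u i = 0.
Proof.
move=> /psumr_eq0P h i; apply/eqP; rewrite -sqrf_eq0; apply/eqP.
by apply: h => // j _; rewrite sqr_ge0.
Qed.

Lemma cauchy_schwarz I (u v : I -> R) :
  (\sum_i u i * v i) ^+ 2 <= (\sum_i u i ^+ 2) * (\sum_i v i ^+ 2).
Proof.
set U := \sum_i u i ^+ 2; set V := \sum_i v i ^+ 2; set W := \sum_i u i * v i.
have [V0|V0] := eqVneq V 0.
  by rewrite V0 /W big1 ?expr0n ?mulr0 // => i _; rewrite (sum_sqr_eq0 V0) mulr0.
have Vp : 0 < V by rewrite lt_def V0 sumr_ge0 // => i _; rewrite sqr_ge0.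
have : 0 <= \sum_i (V * u i - W * v i) ^+ 2.
  by apply: sumr_ge0 => i _; rewrite sqr_ge0.
have -> : \sum_i (V * u i - W * v i) ^+ 2 = V * (U * V - W ^+ 2).
  transitivity (V ^+ 2 * U - 2 * V * W * W + W ^+ 2 * V); last by ring.
  have -> : V ^+ 2 * U = \sum_i V ^+ 2 * u i ^+ 2 by rewrite mulr_sumr.
  have -> : 2 * V * W * W = \sum_i 2 * V * W * (u i * v i) by rewrite mulr_sumr.
  have -> : W ^+ 2 * V = \sum_i W ^+ 2 * v i ^+ 2 by rewrite mulr_sumr.
  by rewrite -sumrB -big_split /=; apply: eq_bigr => i _; ring.
by rewrite pmulr_rge0 // subr_ge0.
Qed.

Lemma cauchy_schwarz_cond I (P : pred I) (u v : I -> R) :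
  (\sum_(i | P i) u i * v i) ^+ 2 <=
    (\sum_(i | P i) u i ^+ 2) * (\sum_(i | P i) v i ^+ 2).
Proof.
rewrite ![\sum_(i | P i) _]big_mkcond /=.
have := cauchy_schwarz (fun i => if P i then u i else 0) (fun i => if P i then v i else 0).
congr (_ ^+ 2 <= _ * _); apply: eq_bigr => i _; case: ifP => _ //.
- by rewrite mul0r.
- by rewrite expr0n.
- by rewrite expr0n.
Qed.

(** Weighted arithmetic-geometric mean inequality, from [expR x >= 1 + x] at
    the deviations of the logarithms from their mean. *)
Lemma weighted_amgm I (e u : I -> R) :
  (forall i, 0 <= e i) -> \sum_i e i = 1 -> (forall i, 0 <= u i) ->
  \prod_i u i `^ e i <= \sum_i e i * u i.
Proof.
move=> e0 e1 u0.
have rhs0 : 0 <= \sum_i e i * u i by apply: sumr_ge0 => i _; rewrite mulr_ge0.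
case: (pickP (fun i => (u i == 0) && (e i != 0))) => [i /andP[/eqP ui ei]|nz].
  by rewrite (bigD1 i) //= ui powR0 // mul0r.
set L := \sum_i e i * ln (u i).
have -> : \prod_i u i `^ e i = expR L.
  rewrite expR_sum; apply: eq_bigr => i _; rewrite /powR.
  have := nz i; case: (u i == 0) => //= /negbFE /eqP ->.
  by rewrite eqxx mul0r expR0.
have -> : expR L = \sum_i e i * (expR L * (1 + (ln (u i) - L))).
  transitivity (expR L * (\sum_i e i * (1 + ln (u i) - L))).
    have -> : \sum_i e i * (1 + ln (u i) - L) = 1; last by rewrite mulr1.
    rewrite (eq_bigr (fun i => e i + e i * ln (u i) - e i * L)).
      by rewrite sumrB big_split /= -mulr_suml e1 mul1r addrK.
    by move=> i _; ring.
  by rewrite mulr_sumr; apply: eq_bigr => i _; ring.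
apply: ler_sum => i _; have := nz i; have [ui|ui] := eqVneq (u i) 0.
  by move=> /negbFE /eqP ->; rewrite !mul0r.
move=> _; apply: ler_wpM2l => //.
have up : 0 < u i by rewrite lt_def ui u0.
apply: (@le_trans _ _ (expR L * expR (ln (u i) - L))).
  by rewrite ler_wpM2l ?expR_ge0 // expR_ge1Dx.
by rewrite -expRD subrKC lnK.
Qed.

(** Bernoulli's inequality for real exponents: the mean inequality for [v `^ x]
    and [1] with weights [1/x] and [1 - 1/x]. *)
Lemma bernoulli (x v : R) : 1 <= x -> 0 <= v -> x * v <= v `^ x + x - 1.
Proof.
move=> x1 v0; have xp : 0 < x by apply: lt_le_trans x1.
pose e (b : bool) := if b then x^-1 else 1 - x^-1.
pose u (b : bool) := if b then v `^ x else 1.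
have := @weighted_amgm bool e u.
rewrite !big_bool /e /u /= powR1 !mulr1 -powRrM mulfV ?gt_eqF // powRr1 // => h.
have {h} : v <= x^-1 * v `^ x + (1 - x^-1).
  apply: h; rewrite ?subrKC //; case=> //; rewrite ?powR_ge0 ?invr_ge0 ?(ltW xp) //.
  by rewrite subr_ge0 invf_le1.
rewrite -(ler_pM2l xp) => /le_trans; apply.
by rewrite mulrDr mulrBr mulrA mulfV ?gt_eqF // mul1r mulr1 addrA.
Qed.

Lemma sum_powR_le I (u : I -> R) (x : R) : 1 <= x -> (forall i, 0 <= u i) ->
  \sum_i u i `^ x <= (\sum_i u i) `^ x.
Proof.
move=> x1 u0; have xp : 0 < x by apply: lt_le_trans x1.
have S0 : 0 <= \sum_i u i by apply: sumr_ge0.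
rewrite -(mulr_powRB1 S0 xp) mulr_suml; apply: ler_sum => i _.
rewrite -(mulr_powRB1 (u0 i) xp) ler_wpM2l //.
apply: ge0_ler_powR; rewrite ?nnegrE ?subr_ge0 //.
by rewrite (bigD1 i) //= lerDl sumr_ge0.
Qed.

Definition avg T (f : T -> R) : R := #|T|%:R^-1 * \sum_t f t.

Lemma avg_le T (f g : T -> R) : (forall t, f t <= g t) -> avg f <= avg g.
Proof.
by move=> fg; rewrite ler_wpM2l ?invr_ge0 ?ler0n // ler_sum.
Qed.

Lemma avg_ge0 T (f : T -> R) : (forall t, 0 <= f t) -> 0 <= avg f.
Proof. by move=> f0; rewrite mulr_ge0 ?invr_ge0 ?ler0n // sumr_ge0. Qed.

Lemma eq_avg T (f g : T -> R) : f =1 g -> avg f = avg g.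
Proof. by move=> fg; rewrite /avg (eq_bigr _ (fun t _ => fg t)). Qed.

Lemma avg_const T (c : R) : (0 < #|T|)%N -> avg (fun _ : T => c) = c.
Proof.
move=> T0; rewrite /avg sumr_const -[c *+ _]mulr_natl mulKf // pnatr_eq0 -lt0n //.
Qed.

Lemma avgD T (f g : T -> R) : avg (fun t => f t + g t) = avg f + avg g.
Proof. by rewrite /avg big_split mulrDr. Qed.

Lemma avgZ T (c : R) (f : T -> R) : avg (fun t => c * f t) = c * avg f.
Proof. by rewrite /avg -mulr_sumr mulrCA. Qed.

Lemma avg_sum T I (f : I -> T -> R) :
  avg (fun t => \sum_i f i t) = \sum_i avg (f i).
Proof. by rewrite /avg exchange_big /= mulr_sumr. Qed.

Lemma avg_tuple_cons T m (f : m.+1.-tuple T -> R) :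
  avg f = avg (fun x => avg (fun t => f (cons_tuple x t))).
Proof.
rewrite /avg sum_tuple_cons !card_tuple expnS natrM invfM -mulrA; congr (_ * _).
by rewrite mulr_sumr.
Qed.

Lemma avg_exchange T T' (f : T -> T' -> R) :
  avg (fun x => avg (f x)) = avg (fun y => avg (f^~ y)).
Proof.
rewrite /avg -!mulr_sumr exchange_big /= mulrCA; congr (_ * _).
Qed.

Lemma avg_powR_le T (f : T -> R) (x : R) :
  1 <= x -> (forall t, 0 <= f t) -> avg f `^ x <= avg (fun t => f t `^ x).
Proof.
move=> x1 f0; have xp : 0 < x by apply: lt_le_trans x1.
have [T0|T0] := posnP #|T|; first by rewrite /avg T0 invr0 !mul0r powR0 ?gt_eqF.
have W0 := avg_ge0 f0; have [W|W] := eqVneq (avg f) 0.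
  by rewrite W powR0 ?gt_eqF //; apply: avg_ge0 => t; rewrite powR_ge0.
have Wp : 0 < avg f by rewrite lt_def W.
have -> : avg f `^ x = avg (fun t => avg f `^ x * (x * (f t / avg f) + (1 - x))).
  have e : avg (fun t => x * (f t / avg f)) = x.
    transitivity (avg (fun t => x / avg f * f t)); last by rewrite avgZ divfK.
    by apply: eq_avg => t; rewrite mulrA mulrAC.
  by rewrite avgZ avgD avg_const // e subrKC mulr1.
apply: avg_le => t.
have -> : f t `^ x = avg f `^ x * (f t / avg f) `^ x.
  by rewrite -powRM ?divr_ge0 // mulrC divfK.
rewrite ler_wpM2l ?powR_ge0 //.
have := bernoulli x1 (divr_ge0 (f0 t) W0); lra.
Qed.

Lemma ex_ge_avg T (f : T -> R) (M : R) : (0 < #|T|)%N -> avg f <= M ->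
  exists t, f t <= M.
Proof.
move=> T0 fM; apply/not_existsP => h.
have : avg (fun t => f t - M) <= 0 by rewrite avgD avg_const // subr_le0.
rewrite leNgt => /negP; apply; rewrite /avg mulr_gt0 ?invr_gt0 ?ltr0n //.
have /card_gt0P[t _] := T0; rewrite (bigD1 t) //= ltr_pwDl //.
  by rewrite subr_gt0 ltNge; apply/negP/h.
by apply: sumr_ge0 => j _; rewrite subr_ge0 ltW // ltNge; apply/negP/h.
Qed.

End Means.

(** * Multilinear forms and their coefficient tensors *)

Section Forms.
Variables (R : realType) (s : scalar_kind).
Notation K := (scalars R s).

Definition eval m n (a : m.-tuple 'I_n -> K) (z : 'I_m -> 'I_n -> K) : K :=
  \sum_j a j * \prod_k z k (tnth j k).

(** The unit ball of [l_p], [r = 1/p], encoded by a subprobability vector [g]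
    that dominates the entries; this treats [p = oo] (where [g `^ 0 = 1], even
    at [g = 0]) on a par with the finite exponents. *)
Definition ball n (r : R) (z : 'I_n -> K) : Prop :=
  exists g : 'I_n -> R,
    [/\ forall i, 0 <= g i, \sum_i g i <= 1 & forall i, modulus (z i) <= g i `^ r].

Definition bounded_by m n (r : 'I_m -> R) (a : m.-tuple 'I_n -> K) (M : R) :=
  forall z, (forall k, ball (r k) (z k)) -> modulus (eval a z) <= M.

Definition fcons (T : Type) m (x : T) (w : 'I_m -> T) (k : 'I_m.+1) : T :=
  if unlift ord0 k is Some k' then w k' else x.

Lemma fcons0 (T : Type) m (x : T) (w : 'I_m -> T) : fcons x w ord0 = x.
Proof. by rewrite /fcons unlift_none. Qed.

Lemma fconsS (T : Type) m (x : T) (w : 'I_m -> T) k :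
  fcons x w (lift ord0 k) = w k.
Proof. by rewrite /fcons liftK. Qed.

Lemma fcons_eta (T : Type) m (w : 'I_m.+1 -> T) :
  fcons (w ord0) (fun k => w (lift ord0 k)) = w.
Proof.
by apply/funext => k; rewrite /fcons; case: unliftP => [j|] ->.
Qed.

Lemma tnth_cons0 (T : Type) m (x : T) (t : m.-tuple T) :
  tnth (cons_tuple x t) ord0 = x.
Proof. by []. Qed.

Lemma tnth_consS (T : Type) m (x : T) (t : m.-tuple T) k :
  tnth (cons_tuple x t) (lift ord0 k) = tnth t k.
Proof. by rewrite tnthS. Qed.

Lemma eval_cons m n (a : m.+1.-tuple 'I_n -> K) z :
  eval a z = \sum_i z ord0 i *
    eval (fun j => a (cons_tuple i j)) (fun k => z (lift ord0 k)).
Proof.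
rewrite /eval sum_tuple_cons; apply: eq_bigr => i _.
rewrite mulr_sumr; apply: eq_bigr => j _.
rewrite big_ord_recl /= tnth0 mulrCA; congr (_ * (_ * _)).
by apply: eq_bigr => k _; rewrite tnth_consS.
Qed.

(** Freezing the first argument contracts the first index of the tensor; this is
    what drives every induction on the number of variables. *)
Lemma eval_contract m n (a : m.+1.-tuple 'I_n -> K) z :
  eval a z = eval (fun j => \sum_i z ord0 i * a (cons_tuple i j))
                  (fun k => z (lift ord0 k)).
Proof.
rewrite eval_cons /eval (eq_bigr _ (fun i _ => mulr_sumr _ _ _ _)) exchange_big /=.
apply: eq_bigr => j _; rewrite mulr_suml; apply: eq_bigr => i _.
by rewrite mulrA.
Qed.

Lemma multilinear_eval m n (A : ('I_m -> 'rV[K]_n) -> K) :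
  multilinear A -> forall z, A z = eval (form_coef A) (fun k => z k ord0).
Proof.
elim: m A => [|m IH] A lA z.
  rewrite /eval sum_tuple0 big_ord0 mulr1; congr (A _).
  by apply/funext => -[].
rewrite eval_cons.
pose Ai i w := A (fcons (delta_mx ord0 i) w).
have -> : A z = \sum_i z ord0 ord0 i * Ai i (fun k => z (lift ord0 k)).
  have := lA z ord0; set f := fun x => A _ => fl.
  have f0 : f 0 = 0 by have := fl (-1) 0 0; rewrite scaler0 addr0 mulN1r addNr.
  have fD x y : f (x + y) = f x + f y by have := fl 1 x y; rewrite scale1r mul1r.
  have fZ c x : f (c *: x) = c * f x by have := fl c x 0; rewrite f0 !addr0.
  have fE x : f x = A (fcons x (fun k => z (lift ord0 k))).
    rewrite /f; congr (A _); apply/funext => k; rewrite /fcons.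
    case: unliftP => [j|] ->; last by rewrite dfwithin.
    by rewrite dfwithout // neq_lift.
  have -> : A z = f (z ord0) by rewrite fE fcons_eta.
  rewrite {1}[z ord0]row_sum_delta (big_morph f fD f0).
  by apply: eq_bigr => i _; rewrite fZ fE.
apply: eq_bigr => i _; congr (_ * _).
rewrite IH => [|w k c x y].
  rewrite /eval; apply: eq_bigr => j _; congr (_ * _).
  rewrite /form_coef /Ai; congr (A _); apply/funext => k; rewrite /fcons.
  by case: unliftP => [l|] ->; rewrite ?tnth_consS ?tnth0.
have e u : fcons (delta_mx ord0 i) (@dfwith 'I_m (fun=> 'rV[K]_n) w k u) =
    @dfwith 'I_m.+1 (fun=> 'rV[K]_n) (fcons (delta_mx ord0 i) w) (lift ord0 k) u.
  apply/funext => l; rewrite /fcons; case: unliftP => [l'|] ->.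
    have [->|kl] := eqVneq k l'; first by rewrite !dfwithin.
    by rewrite !dfwithout ?liftK // (inj_eq lift_inj).
  by rewrite dfwithout ?unlift_none // eq_sym neq_lift.
by rewrite /Ai !e; apply: lA.
Qed.

Definition form_of m n (a : m.-tuple 'I_n -> K) (z : 'I_m -> 'rV[K]_n) : K :=
  eval a (fun k => z k ord0).

Lemma form_of_multilinear m n (a : m.-tuple 'I_n -> K) : multilinear (form_of a).
Proof.
move=> z i c x y; rewrite /form_of /eval mulr_sumr -big_split /=.
apply: eq_bigr => j _; rewrite !(bigD1 i (P := xpredT)) //= !dfwithin !mxE.
have e u : \prod_(k < m | k != i)
      @dfwith 'I_m (fun=> 'rV[K]_n) z i u k ord0 (tnth j k) =
    \prod_(k < m | k != i) z k ord0 (tnth j k).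
  by apply: eq_bigr => k ki; rewrite dfwithout // eq_sym.
by rewrite !e; ring.
Qed.

Lemma form_coefK m n (a : m.-tuple 'I_n -> K) : form_coef (form_of a) = a.
Proof.
apply/funext => j; rewrite /form_coef /form_of /eval (bigD1 j) //=.
rewrite big1 ?mulr1 => [|k _]; last by rewrite mxE !eqxx.
rewrite big1 ?addr0 // => i ij.
have /existsP[k kP] : [exists k, tnth i k != tnth j k].
  apply: contraNT ij => /existsPn h; apply/eqP/eq_from_tnth => k.
  by apply/eqP; have := h k; rewrite negbK.
by rewrite (bigD1 k) //= mxE eqxx (negbTE kP) mul0r mulr0.
Qed.

Lemma lp_norm_ball n (p : \bar R) (z : 'rV[K]_n) : (1 <= p)%E ->
  lp_norm p z <= 1 <-> ball (fine p^-1%E) (z ord0).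
Proof.
case: p => [p||] //; last first.
  move=> _ /=; split=> [h|[g [_ _ h]]].
    exists (fun=> 0); split=> // [|i]; first by rewrite big1 ?ler01.
    rewrite powRr0; apply: le_trans h.
    exact: (@le_bigmax _ _ _ 0 (fun i => modulus (z ord0 i))).
  apply: bigmax_le => // i _; have := h i; by rewrite powRr0.
rewrite lee_fin => p1; have p0 : 0 < p by apply: lt_le_trans p1.
rewrite /= fine_invr; split=> [h|[g [g0 g1 gz]]].
  exists (fun i => modulus (z ord0 i) `^ p); split=> [i||i]; first exact: powR_ge0.
    have S0 : 0 <= \sum_i modulus (z ord0 i) `^ p.
      by apply: sumr_ge0 => i _; exact: powR_ge0.
    have := @ge0_ler_powR R p (ltW p0) _ _ _ _ h.
    rewrite -powRrM mulVf ?gt_eqF // powRr1 // powR1; apply; rewrite ?nnegrE //.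
    exact: powR_ge0.
  by rewrite -powRrM mulfV ?gt_eqF // powRr1 // modulus_ge0.
have S1 : \sum_(i < n) modulus (z ord0 i) `^ p <= 1.
  apply: le_trans g1; apply: ler_sum => i _.
  rewrite -[leRHS]powRr1 // -[1](mulVf (lt0r_neq0 p0)) powRrM.
  by apply: ge0_ler_powR; rewrite ?nnegrE ?modulus_ge0 ?powR_ge0 // ltW.
have := @ge0_ler_powR R p^-1 _ _ _ _ _ S1; rewrite powR1; apply.
- by rewrite invr_ge0 ltW.
- by rewrite nnegrE sumr_ge0 // => i _; exact: powR_ge0.
- by rewrite nnegrE.
Qed.

Lemma powR_le1 (x r : R) : 0 <= x -> x <= 1 -> 0 <= r -> x `^ r <= 1.
Proof.
move=> x0 x1 r0; have := @ge0_ler_powR R r r0 x 1; rewrite powR1 !nnegrE.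
exact.
Qed.

Lemma ball_le1 n r (z : 'I_n -> K) : 0 <= r -> ball r z -> forall i, modulus (z i) <= 1.
Proof.
move=> r0 [g [g0 g1 gz]] i; apply: le_trans (gz i) _.
apply: powR_le1 => //; apply: le_trans g1.
by rewrite (bigD1 i) //= lerDl sumr_ge0.
Qed.

Lemma ball0 n r : ball r (fun _ : 'I_n => 0).
Proof.
exists (fun=> 0); split=> // [|i]; first by rewrite big1 ?ler01.
by rewrite modulus0 powR_ge0.
Qed.

(** All the test vectors below have this shape: signs, phases or their products
    applied to a power of a subprobability vector. *)
Lemma ball_powR n r (g : 'I_n -> R) (u : 'I_n -> K) :
  (forall i, 0 <= g i) -> \sum_i g i <= 1 -> (forall i, modulus (u i) <= 1) ->
  ball r (fun i => u i * real_scalar s (g i `^ r)).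
Proof.
move=> g0 g1 u1; exists g; split=> // i.
rewrite modulusM modulus_real ger0_norm ?powR_ge0 //.
by rewrite ler_piMl ?powR_ge0.
Qed.

Lemma bounded_by_ge0 m n (r : 'I_m -> R) (a : m.-tuple 'I_n -> K) M :
  bounded_by r a M -> 0 <= M.
Proof.
move=> /(_ (fun _ _ => 0)) h; apply: le_trans (modulus_ge0 _) (h _) => k.
exact: ball0.
Qed.

Definition recip m (p : 'I_m -> \bar R) (k : 'I_m) : R := fine (p k)^-1%E.

Lemma recip_ge0 m (p : 'I_m -> \bar R) : (forall k, (1 <= p k)%E) ->
  forall k, 0 <= recip p k.
Proof.
move=> p1 k; rewrite /recip fine_ge0 // inve_ge0.
by apply: le_trans (p1 k); rewrite lee_fin ler01.
Qed.

(** The supremum is finite, as the entries of vectors in the balls have modulus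
    at most one, so that it bounds the values of the form. *)
Lemma form_norm_bound m n (p : 'I_m -> \bar R) (A : ('I_m -> 'rV[K]_n) -> K) :
  (forall k, (1 <= p k)%E) -> multilinear A ->
  bounded_by (recip p) (form_coef A) (form_norm p A).
Proof.
move=> p1 lA z zb.
pose z' k : 'rV[K]_n := \row_i z k i.
have zk k : z' k ord0 = z k by apply/funext => i; rewrite mxE.
have zz : (fun k => z' k ord0) = z by apply/funext => k; exact: zk.
rewrite -{1}zz -multilinear_eval //; apply: sup_upper_bound; last first.
  by exists z' => //= k; apply/lp_norm_ball => //; rewrite zk; apply: zb.
split; first by exists (modulus (A z')), z' => //= k; apply/lp_norm_ball => //;
  rewrite zk; apply: zb.
exists (\sum_j modulus (form_coef A j)) => _ [w wb <-].
rewrite multilinear_eval //; apply: le_trans (modulus_sum _ _ _) _.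
apply: ler_sum => j _; rewrite modulusM ler_piMr ?modulus_ge0 //.
rewrite modulus_prod; apply: prodr_ile1 => k; rewrite modulus_ge0 /=.
have /(lp_norm_ball _ (p1 k)) wk : lp_norm (p k) (w k) <= 1 by exact: wb.
by move=> _; exact: (ball_le1 (recip_ge0 p1 k) wk).
Qed.

Lemma form_norm_le m n (p : 'I_m -> \bar R) (a : m.-tuple 'I_n -> K) M :
  (forall k, (1 <= p k)%E) -> bounded_by (recip p) a M ->
  0 <= form_norm p (form_of a) <= M.
Proof.
move=> p1 ab; apply/andP; split.
  have := form_norm_bound p1 (form_of_multilinear a); exact: bounded_by_ge0.
apply: ge_sup.
  exists (modulus (form_of a (fun=> 0))), (fun=> 0) => //= k; apply/lp_norm_ball => //.
  have -> : (0 : 'rV[K]_n) ord0 = fun=> 0 by apply/funext => i; rewrite mxE.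
  exact: ball0.
by move=> _ [w wb <-]; apply: ab => k; apply/lp_norm_ball.
Qed.

Definition tensor_norm m n (t : 'I_m -> R) (a : m.-tuple 'I_n -> K) : R :=
  nested_sum 1 t (fun j => modulus (a j)).

(** Admissibility as an inequality between tensors, in terms of [r = 1/p]. *)
Definition tensor_admissible m (r t : 'I_m -> R) : Prop :=
  (forall k, 0 < t k) /\ exists C, forall n (a : m.-tuple 'I_n -> K) M,
    (0 < n)%N -> bounded_by r a M -> tensor_norm t a <= C * M.

Lemma admissibleE m (p : 'I_m -> \bar R) t : (forall k, (1 <= p k)%E) ->
  admissible s p t <-> tensor_admissible (recip p) t.
Proof.
move=> p1; split=> -[t0 [C h]]; split=> //.
  exists `|C| => n a M n0 ab; have /andP[N0 NM] := form_norm_le p1 ab.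
  have := h n (form_of a) n0 (@form_of_multilinear _ _ a).
  rewrite /mixed_norm form_coefK => /le_trans; apply.
  apply: (@le_trans _ _ (`|C| * form_norm p (form_of a))).
    by rewrite ler_wpM2r // ler_norm.
  by rewrite ler_wpM2l.
exists C => n A n0 lA; apply: h => //; exact: form_norm_bound.
Qed.

End Forms.

(** * Khinchin's inequality and Littlewood's mixed sums *)

Section Khinchin.
Variable R : realType.

(** Squared norm, in [R ^ T], of the vector sum of the [v i] with signs [e]. *)
Definition rademacher (T : finType) n (v : 'I_n -> T -> R) (e : n.-tuple bool) : R :=
  \sum_t (\sum_i (-1) ^+ tnth e i * v i t) ^+ 2.

Lemma avg_bool (f : bool -> R) : avg f = (f true + f false) / 2.
Proof. by rewrite /avg card_bool big_bool mulrC. Qed.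

Lemma rademacher_ge0 (T : finType) n (v : 'I_n -> T -> R) e : 0 <= rademacher v e.
Proof. by apply: sumr_ge0 => t _; rewrite sqr_ge0. Qed.

Lemma rademacher_cons (T : finType) n (v : 'I_n.+1 -> T -> R) b e :
  rademacher v (cons_tuple b e) =
    rademacher (fun i => v (lift ord0 i)) e + \sum_t v ord0 t ^+ 2 +
    2 * (-1) ^+ b *
      \sum_t (\sum_i (-1) ^+ tnth e i * v (lift ord0 i) t) * v ord0 t.
Proof.
rewrite /rademacher mulr_sumr -!big_split /=; apply: eq_bigr => t _.
rewrite big_ord_recl /= tnth0 (eq_bigr (fun i => (-1) ^+ tnth e i * v (lift ord0 i) t)).
  by case: b; rewrite ?expr1 ?expr0; ring.
by move=> i _; rewrite tnth_consS.
Qed.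

Lemma avg_rademacher (T : finType) n (v : 'I_n -> T -> R) :
  avg (rademacher v) = \sum_i \sum_t v i t ^+ 2.
Proof.
elim: n v => [|n IH] v.
  rewrite big_ord0 (eq_avg (g := fun=> 0)) ?avg_const ?card_tuple //.
  by move=> e; rewrite /rademacher big1 // => t _; rewrite big_ord0 expr0n.
rewrite avg_tuple_cons avg_exchange big_ord_recl -IH addrC.
rewrite -(@avg_const R (n.-tuple bool) (\sum_t v ord0 t ^+ 2)); last first.
  by rewrite card_tuple card_bool expn_gt0.
rewrite -avgD; apply: eq_avg => e.
by rewrite avg_bool !rademacher_cons expr1 expr0; field.
Qed.

(** Fourth moment: conditionally on the other signs the cross term is centred,
    and its square is controlled by Cauchy-Schwarz. *)
Lemma avg_rademacher_sqr (T : finType) n (v : 'I_n -> T -> R) :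
  avg (fun e => rademacher v e ^+ 2) <= 3 * (\sum_i \sum_t v i t ^+ 2) ^+ 2.
Proof.
elim: n v => [|n IH] v.
  rewrite big_ord0 (eq_avg (g := fun=> 0)) ?avg_const ?card_tuple ?expr0n ?mulr0 //.
  by move=> e; rewrite /rademacher big1 ?expr0n // => t _; rewrite big_ord0 expr0n.
rewrite avg_tuple_cons avg_exchange big_ord_recl.
set q := \sum_t v ord0 t ^+ 2; set v' := fun i => v (lift ord0 i).
set S := \sum_(i < n) _.
have cT : (0 < #|{: n.-tuple bool}|)%N by rewrite card_tuple card_bool expn_gt0.
apply: (@le_trans _ _ (avg (fun e : n.-tuple bool =>
    rademacher v' e ^+ 2 + (6 * q * rademacher v' e + q ^+ 2)))).
  apply: avg_le => e; rewrite avg_bool !rademacher_cons expr1 expr0 -/v' -/q.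
  have := cauchy_schwarz (fun t => \sum_i (-1) ^+ tnth e i * v' i t) (v ord0).
  rewrite -/(rademacher v' e) -/q; set c := \sum_t _ * _; set Q := rademacher v' e.
  move=> h.
  have -> : ((Q + q + 2 * -1 * c) ^+ 2 + (Q + q + 2 * 1 * c) ^+ 2) / 2 =
    Q ^+ 2 + (2 * q * Q + 4 * c ^+ 2 + q ^+ 2) by field.
  by rewrite lerD2l lerD2r; lra.
rewrite avgD avgD avgZ avg_const // avg_rademacher -/S.
have := IH v'; rewrite -/S => h.
apply: (@le_trans _ _ (3 * S ^+ 2 + (6 * q * S + q ^+ 2))); first by rewrite lerD2r.
have := sqr_ge0 q; rewrite -subr_ge0 => q2.
have -> : 3 * (q + S) ^+ 2 = 3 * S ^+ 2 + (6 * q * S + q ^+ 2) + 2 * q ^+ 2 by ring.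
by rewrite lerDl mulr_ge0 // sqr_ge0.
Qed.

(** The first moment is bounded below through the second and the fourth, by
    averaging [y >= y ^+ 2 - 4 / 27 * y ^+ 4], that is
    [(y - 3 / 2) ^+ 2 * (y + 3) >= 0]. *)
Lemma khinchin_hilbert (T : finType) n (v : 'I_n -> T -> R) :
  Num.sqrt (\sum_i \sum_t v i t ^+ 2) <=
    2 * avg (fun e => Num.sqrt (rademacher v e)).
Proof.
set S := \sum_i _.
have S0 : 0 <= S by apply: sumr_ge0 => i _; apply: sumr_ge0 => t _; rewrite sqr_ge0.
have [SE|Sn] := eqVneq S 0.
  by rewrite SE sqrtr0 mulr_ge0 ?avg_ge0 // => e; rewrite sqrtr_ge0.
have Sp : 0 < S by rewrite lt_def Sn.
set w := Num.sqrt S; have wp : 0 < w by rewrite sqrtr_gt0.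
have wS : w ^+ 2 = S by rewrite sqr_sqrtr.
have h e : rademacher v e - 4 / 27 / S * rademacher v e ^+ 2 <=
           w * Num.sqrt (rademacher v e).
  set Q := rademacher v e; set x := Num.sqrt Q.
  have x0 : 0 <= x by rewrite sqrtr_ge0.
  have <- : x ^+ 2 = Q by rewrite sqr_sqrtr ?rademacher_ge0.
  rewrite -subr_ge0 -(pmulr_rge0 _ Sp) -wS.
  have -> : w ^+ 2 * (w * x - (x ^+ 2 - 4 / 27 / w ^+ 2 * (x ^+ 2) ^+ 2)) =
    4 / 27 * x * ((x - 3 / 2 * w) ^+ 2 * (x + 3 * w)).
    by field; rewrite gt_eqF.
  apply: mulr_ge0; first by rewrite mulr_ge0 // divr_ge0.
  by apply: mulr_ge0; [exact: sqr_ge0 | rewrite addr_ge0 // mulr_ge0 // ltW].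
have := avg_le h; rewrite avgZ avgD.
rewrite (eq_avg (f := fun e => - (4 / 27 / S * rademacher v e ^+ 2))
  (g := fun e => - (4 / 27 / S) * rademacher v e ^+ 2)); last by move=> e; rewrite mulNr.
rewrite avgZ avg_rademacher -/S => h2.
have h3 : - (4 / 27 / S) * (3 * S ^+ 2) <=
  - (4 / 27 / S) * avg (fun e => rademacher v e ^+ 2).
  rewrite !mulNr lerN2 ler_wpM2l ?avg_rademacher_sqr //.
  by rewrite !mulr_ge0 ?invr_ge0.
have e3 : - (4 / 27 / S) * (3 * S ^+ 2) = - (4 / 9 * S) by field.
rewrite e3 in h3; rewrite -(ler_pM2l wp) -expr2 wS mulrCA.
move: h2 h3; set A := avg _; set B := _ * A; set C := w * _ => h2 h3; lra.
Qed.

End Khinchin.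

Section Littlewood.
Variables (R : realType) (s : scalar_kind).
Notation K := (scalars R s).

Definition signs m n (E : m.-tuple (n.-tuple bool)) (k : 'I_m) (i : 'I_n) : K :=
  (-1) ^+ tnth (tnth E k) i.

(** Khinchin's inequality for multilinear Rademacher sums, one variable at a
    time: the remaining indices are treated as coordinates of a Hilbert space. *)
Lemma khinchin_multilinear m n (c : m.-tuple 'I_n -> K) :
  Num.sqrt (\sum_j modulus (c j) ^+ 2) <=
    2 ^+ m * avg (fun E : m.-tuple (n.-tuple bool) => modulus (eval c (signs E))).
Proof.
elim: m c => [|m IH] c.
  rewrite sum_tuple0 expr0 mul1r sqrtr_sqr ger0_norm ?modulus_ge0 //.
  rewrite (eq_avg (g := fun=> modulus (c [tuple]))) ?avg_const ?card_tuple //.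
  by move=> E; rewrite /eval sum_tuple0 big_ord0 mulr1.
pose v i (t : m.-tuple 'I_n * bool) := coord t.2 (c (cons_tuple i t.1)).
pose d (e : n.-tuple bool) (j : m.-tuple 'I_n) : K :=
  \sum_i (-1) ^+ tnth e i * c (cons_tuple i j).
have -> : \sum_j modulus (c j) ^+ 2 = \sum_i \sum_t v i t ^+ 2.
  rewrite sum_tuple_cons; apply: eq_bigr => i _.
  rewrite -(pair_bigA _ (fun j b => v i (j, b) ^+ 2)) /=.
  by apply: eq_bigr => j _; rewrite modulus_sq.
apply: le_trans (khinchin_hilbert v) _.
rewrite exprS -mulrA ler_wpM2l // avg_tuple_cons -avgZ; apply: avg_le => e.
have -> : rademacher v e = \sum_j modulus (d e j) ^+ 2.
  rewrite /rademacher.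
  rewrite -(pair_bigA _ (fun j b => (\sum_i (-1) ^+ tnth e i * v i (j, b)) ^+ 2)) /=.
  apply: eq_bigr => j _; rewrite modulus_sq; apply: eq_bigr => b _.
  by rewrite coord_sum; congr (_ ^+ 2); apply: eq_bigr => i _; rewrite coord_sign.
apply: le_trans (IH (d e)) _; rewrite ler_wpM2l ?exprn_ge0 //.
apply: avg_le => E.
suff -> : eval (d e) (signs E) = eval c (signs (cons_tuple e E)) by [].
rewrite [RHS]eval_contract /eval; apply: eq_bigr => j _.
congr (_ * _).
by apply: eq_bigr => k _; rewrite /signs tnth_consS.
Qed.

(** Littlewood's mixed sum at position [k], after rescaling the variables by
    [g `^ r]. The signs of the other variables are averaged out by Khinchin's
    inequality, and the phases of the [k]-th variable align the [n] partial
    sums, so that their moduli add up. *)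
Lemma littlewood m n (r : 'I_m -> R) (a : m.-tuple 'I_n -> K) M
    (g : 'I_m -> 'I_n -> R) (k : 'I_m) :
  bounded_by r a M ->
  (forall l i, 0 <= g l i) -> (forall l, \sum_i g l i <= 1) ->
  \sum_i Num.sqrt (\sum_(j | tnth j k == i)
      modulus (a j) ^+ 2 * (\prod_l g l (tnth j l) `^ r l) ^+ 2) <= 2 ^+ m * M.
Proof.
move=> ab g0 g1.
pose b j : K := a j * real_scalar s (\prod_l g l (tnth j l) `^ r l).
pose c i j : K := if tnth j k == i then b j else 0.
have -> : \sum_i Num.sqrt (\sum_(j | tnth j k == i)
      modulus (a j) ^+ 2 * (\prod_l g l (tnth j l) `^ r l) ^+ 2) =
    \sum_i Num.sqrt (\sum_j modulus (c i j) ^+ 2).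
  apply: eq_bigr => i _; congr Num.sqrt; rewrite big_mkcond; apply: eq_bigr => j _.
  rewrite /c; case: ifP; rewrite ?modulus0 ?expr0n // /b.
  by rewrite modulusM modulus_real exprMn real_normK ?num_real.
apply: le_trans (ler_sum _ (fun i _ => khinchin_multilinear (c i))) _.
rewrite -mulr_sumr ler_wpM2l ?exprn_ge0 // -avg_sum.
have M0 := bounded_by_ge0 ab.
have [n0|n0] := posnP #|{: m.-tuple (n.-tuple bool)}|; first by rewrite /avg n0 invr0 mul0r.
rewrite -(avg_const M n0); apply: avg_le => E.
have [u uP] := choice (fun i => polar (eval (c i) (signs E))).
pose z l i : K := (if l == k then u i else 1) * signs E l i * real_scalar s (g l i `^ r l).
have /ab : forall l, ball (r l) (z l).
  move=> l; apply: ball_powR => // i; rewrite mulrC modulus_sign.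
  by case: eqP; rewrite ?modulus1 //; case: (uP i).
suff -> : eval a z = real_scalar s (\sum_i modulus (eval (c i) (signs E))).
  by rewrite modulus_real ger0_norm // sumr_ge0 // => i _; exact: modulus_ge0.
rewrite real_scalar_sum.
rewrite (eq_bigr _ (fun i _ => esym (proj2 (uP i)))) /eval.
under [RHS]eq_bigr => i _ do rewrite mulr_sumr.
rewrite exchange_big /=; apply: eq_bigr => j _.
rewrite [RHS](bigD1 (tnth j k)) //= [X in _ + X]big1 ?addr0 => [|i ik]; last first.
  by rewrite /c eq_sym (negbTE ik) mul0r mulr0.
rewrite /c eqxx /b /z !big_split /=.
have -> : real_scalar s (\prod_l g l (tnth j l) `^ r l) =
    \prod_l real_scalar s (g l (tnth j l) `^ r l).
  exact: (big_morph _ (@real_scalarM R s) (real_scalar1 R s)).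
have -> : \prod_(l < m) (if l == k then u (tnth j l) else 1) = u (tnth j k).
  by rewrite (bigD1 k) //= eqxx big1 ?mulr1 // => l /negbTE ->.
by ring.
Qed.

End Littlewood.

(** * Mixed norms and the cotype inequality *)

Section NestedSums.
Variable R : realType.

Lemma nested_sum_ge0 m n x (t : 'I_m -> R) (a : m.-tuple 'I_n -> R) :
  0 <= nested_sum x t a.
Proof. by case: m t a => [|m] t a /=; exact: powR_ge0. Qed.

Lemma nested_sum_powR m n x y (t : 'I_m -> R) (a : m.-tuple 'I_n -> R) :
  nested_sum (x * y) t a = nested_sum x t a `^ y.
Proof.
case: m t a => [|m] t a /=; first by rewrite powRrM.
by rewrite -powRrM; congr (_ `^ _); rewrite mulrAC.
Qed.

Lemma nested_sum_scale m n x (t : 'I_m -> R) (c : R) (a : m.-tuple 'I_n -> R) :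
  0 <= c -> (forall j, 0 <= a j) -> (forall k, 0 < t k) ->
  nested_sum x t (fun j => c * a j) = c `^ x * nested_sum x t a.
Proof.
elim: m x t a => [|m IH] x t a c0 a0 t0 /=; first by rewrite powRM.
rewrite (eq_bigr (fun i => c `^ t ord0 * nested_sum (t ord0)
   (fun k => t (lift ord0 k)) (fun j => a (cons_tuple i j)))); last first.
  by move=> i _; rewrite IH.
rewrite -mulr_sumr powRM ?powR_ge0 //; last first.
  by apply: sumr_ge0 => i _; exact: nested_sum_ge0.
by rewrite -powRrM; congr (_ `^ _ * _); rewrite mulrC divfK // gt_eqF.
Qed.

Lemma nested_sum0 m n x (t : 'I_m -> R) : x != 0 -> (forall k, 0 < t k) ->
  nested_sum x t (fun _ : m.-tuple 'I_n => 0) = 0.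
Proof.
elim: m x t => [|m IH] x t x0 t0 /=; first by rewrite powR0.
rewrite big1 => [|i _]; last by rewrite IH // gt_eqF.
by rewrite powR0 // mulf_neq0 // invr_eq0 gt_eqF.
Qed.

Lemma nested_sum_two m n x (t : 'I_m -> R) (a : m.-tuple 'I_n -> R) :
  (forall k, t k = 2) -> (forall j, 0 <= a j) ->
  nested_sum x t a = (\sum_j a j ^+ 2) `^ (x / 2).
Proof.
elim: m x t a => [|m IH] x t a t2 a0 /=.
  rewrite sum_tuple0 -(powR_mulrn 2) // -powRrM; congr (_ `^ _).
  by rewrite mulrC divfK.
rewrite t2 sum_tuple_cons; congr (_ `^ _); apply: eq_bigr => i _.
rewrite IH // divff ?pnatr_eq0 // powRr1 // sumr_ge0 // => j _.
by rewrite sqr_ge0.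
Qed.

Variable s : scalar_kind.
Notation K := (scalars R s).

(** Cotype [q] of [l_{t_1}(l_{t_2}(...))] with constant one, for nonincreasing
    exponents between [2] and [q]. Scalars have cotype [2] by orthogonality of
    the signs; each further layer only uses that [l_q] norms decrease in [q]
    and that averages of powers increase. *)
Lemma cotype m n N (q : R) (t : 'I_m -> R) (y : 'I_N -> m.-tuple 'I_n -> K) :
  2 <= q -> (forall k, 2 <= t k <= q) ->
  (forall k l : 'I_m, (k <= l)%N -> t l <= t k) ->
  \sum_i nested_sum q t (fun j => modulus (y i j)) <=
    avg (fun e : N.-tuple bool =>
      nested_sum q t (fun j => modulus (\sum_i (-1) ^+ tnth e i * y i j))).
Proof.
elim: m q t y => [|m IH] q t y q2 tq tmono.
  rewrite /=; set v := fun i b => coord b (y i [tuple]).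
  have sqK (z : K) : modulus z `^ q = (modulus z ^+ 2) `^ (q / 2).
    rewrite -(powR_mulrn 2) ?modulus_ge0 // -powRrM; congr (_ `^ _).
    by rewrite mulrC divfK.
  have q1 : 1 <= q / 2 by rewrite ler_pdivlMr ?mul1r.
  rewrite (eq_bigr _ (fun i _ => sqK _)).
  apply: le_trans (sum_powR_le q1 _) _ => [i|]; first exact: sqr_ge0.
  have -> : \sum_i modulus (y i [tuple]) ^+ 2 = avg (rademacher v).
    by rewrite avg_rademacher; apply: eq_bigr => i _; rewrite modulus_sq.
  apply: le_trans (avg_powR_le q1 _) _ => [e|]; first exact: rademacher_ge0.
  apply: avg_le => e; rewrite sqK modulus_sq /rademacher.
  under [X in _ <= X `^ _]eq_bigr => b _ do
    rewrite coord_sum (eq_bigr _ (fun i _ => coord_sign b (tnth e i) _)).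
  by [].
pose t' k := t (lift ord0 k); have /andP[t2 t0q] := tq ord0.
have t0 : 0 < t ord0 by apply: lt_le_trans t2.
have q1 : 1 <= q / t ord0 by rewrite ler_pdivlMr ?mul1r.
have IHt (l : 'I_n) := IH (t ord0) t' (fun i j => y i (cons_tuple l j)) t2.
apply: le_trans (sum_powR_le q1 _) _.
  by move=> i; apply: sumr_ge0 => l _; exact: nested_sum_ge0.
rewrite exchange_big /=.
apply: (@le_trans _ _ (avg (fun e : N.-tuple bool => \sum_l nested_sum (t ord0) t'
    (fun j => modulus (\sum_i (-1) ^+ tnth e i * y i (cons_tuple l j)))) `^ (q / t ord0))).
  apply: ge0_ler_powR.
  - by apply: le_trans q1.
  - by rewrite nnegrE; apply: sumr_ge0 => l _; apply: sumr_ge0 => i _;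
      exact: nested_sum_ge0.
  - by rewrite nnegrE avg_ge0 // => e; apply: sumr_ge0 => l _; exact: nested_sum_ge0.
  rewrite avg_sum; apply: ler_sum => l _; apply: IHt.
    move=> k; have /andP[-> _] := tq (lift ord0 k); exact: tmono.
  by move=> k l' kl; apply: tmono; rewrite /= /bump.
apply: le_trans (avg_powR_le q1 _) _ => [e|//].
by apply: sumr_ge0 => l _; exact: nested_sum_ge0.
Qed.

End NestedSums.

(** * The inequality *)

Section Inequality.
Variables (R : realType) (s : scalar_kind).
Notation K := (scalars R s).

Lemma sum_tuple_head (T : finType) m (i : T) (F : m.+1.-tuple T -> R) :
  \sum_(j | tnth j ord0 == i) F j = \sum_j F (cons_tuple i j).
Proof.
rewrite big_mkcond sum_tuple_cons (bigD1 i) //= [X in _ + X]big1 ?addr0.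
  by apply: eq_bigr => j _; rewrite tnth_cons0 eqxx.
by move=> l li; rewrite big1 // => j _; rewrite tnth_cons0 (negbTE li).
Qed.

Lemma prod_powR (I : finType) (x : R) (e : I -> R) : 0 < x ->
  \prod_i x `^ e i = x `^ (\sum_i e i).
Proof.
move=> x0; rewrite [RHS](big_morph (powR x) (id1 := 1) (op1 := *%R)) ?powRr0 //.
by move=> u v; rewrite powRD // (gt_eqF x0) implybT.
Qed.

Section Core.
Variables (m n : nat) (r : 'I_m.+1 -> R) (a : m.+1.-tuple 'I_n -> K) (M : R).
Hypothesis r0 : forall k, 0 <= r k.
Let lam2 := \sum_(k < m) r (lift ord0 k).
Let lam := r ord0 + lam2.
Hypothesis lam2_half : lam2 <= 2^-1.
Hypothesis lam_lt1 : lam < 1.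
Hypothesis ab : bounded_by r a M.

Let sg := (1 - lam)^-1.
Let S i := Num.sqrt (\sum_j modulus (a (cons_tuple i j)) ^+ 2).
Let D := \sum_i S i `^ sg.
(** A probability on the multi-indices when [D] is positive: the first index is
    drawn proportionally to [S i `^ sg], the others proportionally to the squared
    moduli; [q l] is its [l]-th marginal. *)
Let mu j := modulus (a j) ^+ 2 * S (tnth j ord0) `^ (sg - 2) / D.
Let q l i := \sum_(j | tnth j l == i) mu j.
(** Weights of total mass one, which make [G] a geometric mean of the marginals;
    their nonnegativity is where [lam2 <= 1/2] is needed. *)
Let e (l : 'I_m.+1) := if l == ord0 then 1 - 2 * lam2 else 2 * r l.
Let G j := \prod_l q l (tnth j l) `^ e l.
Let c := D `^ (1 - lam).

Let sg_gt0 : 0 < sg. Proof. by rewrite invr_gt0 subr_gt0. Qed.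
Let S_ge0 i : 0 <= S i. Proof. exact: sqrtr_ge0. Qed.
Let D_ge0 : 0 <= D. Proof. by apply: sumr_ge0 => i _; exact: powR_ge0. Qed.
Let mu_ge0 j : 0 <= mu j.
Proof.
by apply: divr_ge0 => //; apply: mulr_ge0; [exact: sqr_ge0 | exact: powR_ge0].
Qed.
Let q_ge0 l i : 0 <= q l i. Proof. by apply: sumr_ge0. Qed.
Let mu_le_q l j : mu j <= q l (tnth j l).
Proof. by rewrite /q (bigD1 j) //= lerDl sumr_ge0. Qed.

Let e_ge0 l : 0 <= e l.
Proof.
rewrite /e; case: ifP => _; last by rewrite mulr_ge0.
by rewrite subr_ge0; have := lam2_half; lra.
Qed.

Let e_head : e ord0 = 1 - 2 * lam2. Proof. by []. Qed.

Let e_lift k : e (lift ord0 k) = 2 * r (lift ord0 k). Proof. by []. Qed.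

Let sum_e : \sum_l e l = 1.
Proof.
rewrite big_ord_recl e_head (eq_bigr _ (fun k _ => e_lift k)) -mulr_sumr.
by rewrite subrK.
Qed.

Let q_head i : q ord0 i = S i `^ sg / D.
Proof.
rewrite /q sum_tuple_head /mu; under eq_bigr do rewrite tnth_cons0.
rewrite -!mulr_suml; congr (_ / D).
have -> : \sum_j modulus (a (cons_tuple i j)) ^+ 2 = S i ^+ 2.
  by rewrite sqr_sqrtr // sumr_ge0 // => j _; rewrite sqr_ge0.
have [->|Si] := eqVneq (S i) 0; first by rewrite expr0n mul0r powR0 // gt_eqF.
by rewrite -(powR_mulrn 2) // -powRD ?Si ?implybT // subrKC.
Qed.

Let sum_mu : 0 < D -> \sum_j mu j = 1.
Proof.
move=> D0; rewrite (partition_big (fun j => tnth j ord0) xpredT) //=.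
by rewrite (eq_bigr _ (fun i _ => q_head i)) -mulr_suml mulfV // gt_eqF.
Qed.

Let sum_q l : 0 < D -> \sum_i q l i = 1.
Proof.
by move=> D0; rewrite -(sum_mu D0) [RHS](partition_big (fun j => tnth j l) xpredT).
Qed.

(** The exponents of [mu] and [G] are tuned so that the rescaled squares are
    proportional to [mu * G], whatever the position distinguished afterwards. *)
Let rescaled j : 0 < D ->
  modulus (a j) ^+ 2 * (\prod_l q l (tnth j l) `^ r l) ^+ 2 = c ^+ 2 * (mu j * G j).
Proof.
move=> D0; have [a0|a0] := eqVneq (modulus (a j)) 0.
  by rewrite /mu a0 expr0n !mul0r mulr0.
set i := tnth j ord0.
have ap : 0 < modulus (a j) by rewrite lt_def a0 modulus_ge0.
have Sp : 0 < S i.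
  rewrite sqrtr_gt0 -(sum_tuple_head i (fun j => modulus (a j) ^+ 2)).
  rewrite (bigD1 j) //= ltr_pwDl ?exprn_gt0 // sumr_ge0 // => l _.
  by rewrite sqr_ge0.
rewrite /G /mu -/i !big_ord_recl -/i e_head.
set P := \prod_(k < m) q _ _ `^ r _.
have -> : \prod_(k < m) q (lift ord0 k) (tnth j (lift ord0 k)) `^ e (lift ord0 k) = P ^+ 2.
  rewrite /P -prodrXl; apply: eq_bigr => k _.
  rewrite e_lift mulrC powRrM powR_mulrn //.
  exact: powR_ge0.
rewrite q_head /c -{1 3}(lnK Sp) -{1 2 3 4}(lnK D0).
set x := ln (S i); set y := ln D.
rewrite -!expRM -!expRN -!expRD -!expRM exprMn -!expRM_natl.
transitivity (modulus (a j) ^+ 2 * P ^+ 2 *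
  expR (2 * ((x * sg - y) * r ord0))); first by rewrite mulrCA mulrC -!mulrA.
transitivity (modulus (a j) ^+ 2 * P ^+ 2 *
  expR (2 * (y * (1 - lam)) + (x * (sg - 2) - y + (x * sg - y) * (1 - 2 * lam2)))).
  congr (_ * expR _).
  have -> : sg = (1 - lam)^-1 by []. rewrite /lam.
  have h : 1 - (r ord0 + lam2) != 0 by rewrite gt_eqF // subr_gt0.
  by field.
have -> : S i `^ (sg - 2) = expR (x * (sg - 2)) by rewrite expRM lnK.
by rewrite !expRD; ring.
Qed.

(** Littlewood's sum at position [k] is bounded below by Cauchy-Schwarz on each
    fibre of the [k]-th coordinate, whose mass is [q k i]. *)
Let fibre k : 0 < D ->
  c * (\sum_j mu j * Num.sqrt (G j / q k (tnth j k))) <= 2 ^+ m.+1 * M.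
Proof.
move=> D0.
have q1 l : \sum_i q l i <= 1 by rewrite sum_q.
apply: le_trans (littlewood k ab q_ge0 q1).
rewrite (partition_big (fun j => tnth j k) xpredT) //= mulr_sumr.
apply: ler_sum => i _.
rewrite (eq_bigr _ (fun j _ => rescaled j D0)) -mulr_sumr sqrtrM ?sqr_ge0 //.
rewrite sqrtr_sqr ger0_norm ?powR_ge0 // ler_wpM2l ?powR_ge0 //.
have G0 j : 0 <= G j by apply: prodr_ge0 => l _; exact: powR_ge0.
have mG j : 0 <= mu j * G j by rewrite mulr_ge0.
have mq j : 0 <= mu j / q k i by rewrite divr_ge0.
have := @cauchy_schwarz_cond R _ (fun j : m.+1.-tuple 'I_n => tnth j k == i)
  (fun j => Num.sqrt (mu j * G j)) (fun j => Num.sqrt (mu j / q k i)).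
rewrite (eq_bigr (fun j => mu j * Num.sqrt (G j / q k (tnth j k)))); last first.
  move=> j /eqP <-; rewrite -sqrtrM // mulrACA -expr2 sqrtrM ?sqr_ge0 //.
  by rewrite sqrtr_sqr ger0_norm.
rewrite (eq_bigr _ (fun j _ => sqr_sqrtr (mG j))).
rewrite (eq_bigr _ (fun j _ => sqr_sqrtr (mq j))) -mulr_suml -/(q k i).
set X := \sum_(j | _) mu j * Num.sqrt _; set Y := \sum_(j | _) mu j * G j => h.
have Y0 : 0 <= Y by apply: sumr_ge0.
have X0 : 0 <= X by apply: sumr_ge0 => j _; rewrite mulr_ge0 ?sqrtr_ge0.
rewrite -(@ler_pXn2r _ 2) ?nnegrE ?sqrtr_ge0 // sqr_sqrtr //.
apply: le_trans h _; rewrite ler_piMr //.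
by have [->|qk] := eqVneq (q k i) 0; rewrite ?mul0r ?ler01 ?divff.
Qed.

(** The smallest marginal lies below the geometric mean, so that one term of the
    sum is at least one. *)
Let pointwise j : 0 < mu j ->
  1 <= \sum_k Num.sqrt (G j / q k (tnth j k)).
Proof.
move=> mj; pose k := [arg min_(k < ord0 | true) q k (tnth j k)]%O.
have qk l : q k (tnth j k) <= q l (tnth j l).
  by rewrite /k; case: arg_minP => // i _ h; apply: h.
have q0 : 0 < q k (tnth j k) by apply: lt_le_trans mj (mu_le_q k j).
rewrite (bigD1 k) //= ler_wpDr //; first by apply: sumr_ge0 => l _; rewrite sqrtr_ge0.
rewrite -[leLHS]sqrtr1 ler_sqrt; last first.
  apply: divr_ge0; last exact: ltW.
  by apply: prodr_ge0 => l _; exact: powR_ge0.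
have qw := ltW q0.
rewrite ler_pdivlMr // mul1r -[leLHS]powRr1 // -sum_e -prod_powR //.
rewrite /G; apply: ler_prod => l _; rewrite powR_ge0 /=.
by apply: ge0_ler_powR; rewrite ?nnegrE.
Qed.

(** The case where all the exponents but the first are [2]. The [m.+1] mixed
    sums of Littlewood, tested at the same vectors [q l `^ r l], add up to at
    least [c]: at each multi-index one of them is large enough. *)
Lemma core_bound :
  (\sum_i Num.sqrt (\sum_j modulus (a (cons_tuple i j)) ^+ 2) `^ (1 - lam)^-1)
    `^ (1 - lam) <= m.+1%:R * 2 ^+ m.+1 * M.
Proof.
rewrite -/sg -/D -/c.
have M0 := bounded_by_ge0 ab.
have [DE|Dn] := eqVneq D 0.
  rewrite /c DE powR0; first by rewrite !mulr_ge0 ?exprn_ge0.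
  by rewrite gt_eqF // subr_gt0.
have D0 : 0 < D by rewrite lt_def Dn.
have -> : m.+1%:R * 2 ^+ m.+1 * M = \sum_(k < m.+1) 2 ^+ m.+1 * M.
  by rewrite sumr_const card_ord -mulrA mulr_natl.
apply: le_trans (ler_sum _ (fun k _ => fibre k D0)).
rewrite -mulr_sumr -[leLHS]mulr1 ler_wpM2l ?powR_ge0 // -(sum_mu D0) exchange_big /=.
apply: ler_sum => j _; rewrite -mulr_sumr.
have := mu_ge0 j; rewrite le_eqVlt => /predU1P[<-|mj]; first by rewrite mul0r.
by rewrite ler_peMr ?pointwise // ltW.
Qed.

End Core.

End Inequality.

Section MainInequality.
Variables (R : realType) (s : scalar_kind).
Notation K := (scalars R s).

Definition tail m (r : 'I_m -> R) (k : nat) : R := \sum_(i < m | (k <= i)%N) r i.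

(** The exponents of the theorem, with the case distinction made on the tail
    sums: unlike the index of the last large tail, it is stable under removing
    the first variable. *)
Definition exponent m (r : 'I_m -> R) (k : 'I_m) : R :=
  if 2^-1 <= tail r k then (1 - tail r k)^-1 else 2.

Definition behead_fun (T : Type) m (r : 'I_m.+1 -> T) (k : 'I_m) : T :=
  r (lift ord0 k).

Lemma tail0 m (r : 'I_m -> R) : tail r 0 = \sum_k r k.
Proof. by apply: eq_bigl. Qed.

Lemma tail_behead m (r : 'I_m.+1 -> R) k : tail r k.+1 = tail (behead_fun r) k.
Proof. by rewrite /tail big_mkcond big_ord_recl /= add0r [RHS]big_mkcond. Qed.

Lemma tail_recl m (r : 'I_m.+1 -> R) : tail r 0 = r ord0 + tail r 1.
Proof. by rewrite tail_behead !tail0 big_ord_recl. Qed.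

Lemma tail_le m (r : 'I_m -> R) (k l : nat) : (forall i, 0 <= r i) ->
  (k <= l)%N -> tail r l <= tail r k.
Proof.
move=> r0 kl; rewrite /tail big_mkcond [leRHS]big_mkcond; apply: ler_sum => i _.
case: ifP => [li|_]; first by rewrite (leq_trans kl li).
by case: ifP.
Qed.

Lemma exponent_behead m (r : 'I_m.+1 -> R) k :
  exponent r (lift ord0 k) = exponent (behead_fun r) k.
Proof. by rewrite /exponent -!tail_behead. Qed.

Lemma exponent_bounds m (r : 'I_m -> R) k : (forall i, 0 <= r i) ->
  2^-1 <= tail r 0 < 1 -> 2 <= exponent r k <= (1 - tail r 0)^-1.
Proof.
move=> r0 /andP[h1 h2]; have h := tail_le r0 (leq0n k).
have two (x : R) : 2^-1 <= x -> x < 1 -> 2 <= (1 - x)^-1.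
  by move=> x1 x2; rewrite -[2]invrK lef_pV2 ?posrE ?invr_gt0 ?subr_gt0 //; lra.
rewrite /exponent; case: ifP => hk; last by rewrite lexx two.
rewrite two //=; last exact: le_lt_trans h2.
by rewrite lef_pV2 ?posrE ?subr_gt0 ?lerD2l ?lerN2 // (le_lt_trans h).
Qed.

Lemma exponent_mono m (r : 'I_m -> R) (k l : 'I_m) : (forall i, 0 <= r i) ->
  2^-1 <= tail r 0 < 1 -> (k <= l)%N -> exponent r l <= exponent r k.
Proof.
move=> r0 h kl; have /andP[h1 h2] := h; have hkl := tail_le r0 kl.
have /andP[hk _] := exponent_bounds k r0 h.
rewrite {1}/exponent; case: ifP => // hl; rewrite /exponent (le_trans hl) //.
have k1 : tail r k < 1 by apply: le_lt_trans h2; exact: tail_le.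
by rewrite lef_pV2 ?posrE ?subr_gt0 ?lerD2l ?lerN2 // (le_lt_trans hkl).
Qed.

Lemma bounded_by_contract m n (r : 'I_m.+1 -> R) (a : m.+1.-tuple 'I_n -> K) M z :
  bounded_by r a M -> ball (r ord0) z ->
  bounded_by (behead_fun r) (fun j => \sum_i z i * a (cons_tuple i j)) M.
Proof.
move=> ab zb w wb.
have := ab (fcons z w); rewrite eval_contract.
have -> : (fun k => fcons z w (lift ord0 k)) = w.
  by apply/funext => k; rewrite fconsS.
rewrite fcons0; apply => k; rewrite /fcons.
by case: unliftP => [l|] -> //; exact: wb.
Qed.

(** One more variable when the remaining ones already satisfy
    [tail r 1 >= 1/2]: freezing the first variable yields an operator from
    [l_p] to a mixed-norm space of cotype [q]; the optimal multiplier for its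
    values on the unit vectors trades [1/q] for [1/q - 1/p]. *)
Lemma exponent_step m n (r : 'I_m.+1 -> R) (a : m.+1.-tuple 'I_n -> K) (C M : R) :
  (forall k, 0 <= r k) -> 2^-1 <= tail r 1 -> tail r 0 < 1 -> 0 <= C ->
  (forall (b : m.-tuple 'I_n -> K), bounded_by (behead_fun r) b M ->
     tensor_norm (exponent (behead_fun r)) b <= C * M) ->
  bounded_by r a M -> tensor_norm (exponent r) a <= C * M.
Proof.
move=> r0 h1 h0 C0 IH ab; have M0 := bounded_by_ge0 ab.
set r' := behead_fun r; set t' := exponent r'.
have r'0 k : 0 <= r' k by exact: r0.
have h10 : tail r 1 <= tail r 0 := tail_le r0 (leq0n 1).
have h1' : tail r 1 < 1 := le_lt_trans h10 h0.
have hr' : 2^-1 <= tail r' 0 < 1 by rewrite -tail_behead h1.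
set q := (1 - tail r 1)^-1; set x := (1 - tail r 0)^-1.
have q0 : 0 < q by rewrite invr_gt0 subr_gt0.
have x0 : 0 < x by rewrite invr_gt0 subr_gt0.
have t'0 k : 0 < t' k.
  by have /andP[h _] := exponent_bounds k r'0 hr'; apply: lt_le_trans h.
pose al i := nested_sum 1 t' (fun j => modulus (a (cons_tuple i j))).
have al0 i : 0 <= al i by exact: nested_sum_ge0.
have alE y i : nested_sum y t' (fun j => modulus (a (cons_tuple i j))) = al i `^ y.
  by rewrite -nested_sum_powR mul1r.
set D := \sum_i al i `^ x.
have D0 : 0 <= D by apply: sumr_ge0 => i _; exact: powR_ge0.
have -> : tensor_norm (exponent r) a = D `^ x^-1.
  have e0 : exponent r ord0 = x by rewrite /exponent (le_trans h1 h10).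
  rewrite /tensor_norm /= e0 div1r; congr (_ `^ _); apply: eq_bigr => i _.
  rewrite -alE; congr (nested_sum _ _ _).
  by apply/funext => k; exact: exponent_behead.
have [DE|Dn] := eqVneq D 0.
  by rewrite DE powR0 ?mulr_ge0 // invr_eq0 gt_eqF.
have Dp : 0 < D by rewrite lt_def Dn.
pose w i := al i `^ x / D.
have w0 i : 0 <= w i by rewrite divr_ge0 ?powR_ge0.
have w1 : \sum_i w i <= 1 by rewrite -mulr_suml divff.
pose y i j : K := real_scalar s (w i `^ r ord0) * a (cons_tuple i j).
have sum_le : \sum_i nested_sum q t' (fun j => modulus (y i j)) <= (C * M) `^ q.
  have tq k : 2 <= t' k <= q by rewrite /q tail_behead exponent_bounds.
  have q2 : 2 <= q.
    rewrite -[2]invrK lef_pV2 ?posrE ?invr_gt0 ?subr_gt0 //.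
    by move: h1; lra.
  apply: le_trans (cotype y q2 tq _) _ => [k l kl|]; first exact: exponent_mono.
  rewrite -[leRHS](@avg_const R (n.-tuple bool)) ?card_tuple ?card_bool ?expn_gt0 //.
  apply: avg_le => e.
  pose z i : K := (-1) ^+ tnth e i * real_scalar s (w i `^ r ord0).
  have zb : ball (r ord0) z.
    apply: ball_powR => // i; rewrite -[X in modulus X]mulr1 modulus_sign.
    by rewrite modulus1.
  have := IH _ (bounded_by_contract ab zb).
  rewrite -[X in nested_sum X _ _]mul1r nested_sum_powR => h.
  apply: (ge0_ler_powR (ltW q0)); rewrite ?nnegrE ?nested_sum_ge0 ?mulr_ge0 //.
  apply: le_trans h; rewrite /tensor_norm le_eqVlt; apply/orP; left; apply/eqP.
  congr (nested_sum _ _ _); apply/funext => j; congr (modulus _).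
  by apply: eq_bigr => i _; rewrite /z /y mulrA.
have term i : nested_sum q t' (fun j => modulus (y i j)) =
    D `^ (- (r ord0 * q)) * al i `^ x.
  have -> : (fun j => modulus (y i j)) =
      (fun j => w i `^ r ord0 * modulus (a (cons_tuple i j))).
    apply/funext => j; rewrite modulusM modulus_real ger0_norm ?powR_ge0 //.
  rewrite nested_sum_scale ?powR_ge0 //; last by move=> j; exact: modulus_ge0.
  rewrite alE; have [->|an] := eqVneq (al i) 0.
    by rewrite powR0 ?gt_eqF // powR0 ?gt_eqF // !mulr0.
  have ap : 0 < al i by rewrite lt_def an al0.
  rewrite /w -(lnK ap) -(lnK Dp); set u := ln _; set v := ln _.
  rewrite -!expRM -!expRN -!expRD -!expRM -!expRD; congr (expR _).
  have xE : x = (1 - (r ord0 + tail r 1))^-1 by rewrite -tail_recl.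
  have d1 : 1 - tail r 1 != 0 by rewrite gt_eqF // subr_gt0.
  have d0 : 1 - (r ord0 + tail r 1) != 0 by rewrite -tail_recl gt_eqF // subr_gt0.
  by rewrite xE /q; field; rewrite d0 d1.
move: sum_le; rewrite (eq_bigr _ (fun i _ => term i)) -mulr_sumr -/D.
rewrite -[X in _ * X]powRr1 // -powRD ?Dn ?implybT // => h.
have qi : 0 <= q^-1 by rewrite invr_ge0 ltW.
have := @ge0_ler_powR R q^-1 qi _ _ _ _ h; rewrite !nnegrE !powR_ge0 => /(_ isT isT).
rewrite -!powRrM mulfV ?gt_eqF // powRr1 ?mulr_ge0 //.
have -> // : (- (r ord0 * q) + 1) / q = x^-1.
rewrite mulrDl mulNr mulfK ?gt_eqF // mul1r /q /x !invrK tail_recl.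
by ring.
Qed.

Lemma exponent_inequality m n (r : 'I_m -> R) (a : m.-tuple 'I_n -> K) M :
  (forall k, 0 <= r k) -> 2^-1 <= tail r 0 -> tail r 0 < 1 ->
  bounded_by r a M -> tensor_norm (exponent r) a <= m%:R * 2 ^+ m * M.
Proof.
elim: m r a => [|m IH] r a r0 h0 h1 ab.
  by move: h0; rewrite tail0 big_ord0; lra.
have M0 := bounded_by_ge0 ab.
case: (leP 2^-1 (tail r 1)) => h.
  apply: (@le_trans _ _ (m%:R * 2 ^+ m * M)).
    apply: (@exponent_step m n r a (m%:R * 2 ^+ m) M) => // b.
    apply: IH => [k||]; [exact: r0 | by rewrite -tail_behead |].
    by rewrite -tail_behead; apply: le_lt_trans h1; exact: tail_le.
  by rewrite ler_wpM2r // ler_pM ?exprn_ge0 ?ler_nat // ler_eXn2l ?ltr1n.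
have t2 k : exponent r (lift ord0 k) = 2.
  rewrite /exponent ifF //; apply/negbTE; rewrite -ltNge.
  by apply: le_lt_trans h; exact: tail_le.
have -> : tensor_norm (exponent r) a =
    (\sum_i Num.sqrt (\sum_j modulus (a (cons_tuple i j)) ^+ 2)
      `^ (1 - tail r 0)^-1) `^ (1 - tail r 0).
  have e0 : exponent r ord0 = (1 - tail r 0)^-1 by rewrite /exponent h0.
  rewrite /tensor_norm /= e0 div1r invrK; congr (_ `^ _).
  apply: eq_bigr => i _; rewrite nested_sum_two //; last by move=> j; exact: modulus_ge0.
  rewrite -powR12_sqrt ?sumr_ge0 // => [|j _]; last exact: sqr_ge0.
  by rewrite -powRrM mulrC.
have e : tail r 0 = r ord0 + \sum_(k < m) r (lift ord0 k).
  by rewrite tail_recl tail_behead tail0.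
rewrite e; apply: core_bound => //; last by rewrite -e.
by move: h; rewrite tail_behead tail0 => /ltW.
Qed.

End MainInequality.

(** * Lower bounds from diagonal forms *)

Section DiagonalForms.
Variables (R : realType) (s : scalar_kind).
Notation K := (scalars R s).

(** Freezing the first variable at a unit vector transfers admissibility to the
    remaining variables, so that a necessary condition on the first exponent
    yields one on every exponent. *)
Lemma admissible_behead m (r t : 'I_m.+1 -> R) : (forall k, 0 <= r k) ->
  tensor_admissible s r t ->
  tensor_admissible s (behead_fun r) (behead_fun t).
Proof.
move=> r0 [t0 [C h]]; split=> [k|]; first exact: t0.
exists C => n b M n0 bb.
pose i0 := Ordinal n0.
pose a (j : m.+1.-tuple 'I_n) : K :=
  if tnth j ord0 == i0 then b (behead_tuple j) else 0.
have aE i j : a (cons_tuple i j) = if i == i0 then b j else 0.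
  rewrite /a tnth_cons0; case: ifP => // _; congr (b _); exact: val_inj.
have ab : bounded_by r a M.
  move=> z zb; rewrite eval_cons (bigD1 i0) //= [X in _ + X]big1 ?addr0; last first.
    move=> i ii; rewrite /eval big1 ?mulr0 // => j _.
    by rewrite aE (negbTE ii) mul0r.
  have -> : (fun j => a (cons_tuple i0 j)) = b.
    by apply/funext => j; rewrite aE eqxx.
  rewrite modulusM -[M]mul1r; apply: ler_pM; try exact: modulus_ge0.
    exact: (ball_le1 (r0 ord0) (zb ord0)).
  by apply: bb => k; exact: zb.
have := h n a M n0 ab; congr (_ <= _).
rewrite /tensor_norm /= (bigD1 i0) //= [X in _ + X]big1 ?addr0 => [|i ii].
  rewrite -nested_sum_powR mulrC divfK ?gt_eqF //; congr (nested_sum _ _ _).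
  by apply/funext => j; rewrite aE eqxx.
have -> : (fun j => modulus (a (cons_tuple i j))) = fun=> 0.
  by apply/funext => j; rewrite aE (negbTE ii) modulus0.
by rewrite nested_sum0 ?gt_eqF // => k; exact: t0.
Qed.

Lemma nested_sum_delta m n x (t : 'I_m -> R) (j0 : m.-tuple 'I_n) :
  x != 0 -> (forall k, 0 < t k) ->
  nested_sum x t (fun j => (j == j0)%:R) = 1.
Proof.
elim: m x t j0 => [|m IH] x t j0 x0 t0 /=.
  by rewrite (_ : _ == _) ?powR1 //; apply/eqP/esym; exact: tuple0.
rewrite (bigD1 (thead j0)) //= [X in _ + X]big1 ?addr0 => [|i ii].
  have -> : (fun j => (cons_tuple (thead j0) j == j0)%:R : R) =
      fun j => (j == behead_tuple j0)%:R.
    apply/funext => j; congr (_%:R); rewrite {2}(tuple_eta j0) -!val_eqE /=.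
    by rewrite eqseq_cons eqxx.
  by rewrite IH ?powR1 // gt_eqF.
have -> : (fun j => (cons_tuple i j == j0)%:R : R) = fun=> 0.
  apply/funext => j; rewrite {1}(tuple_eta j0) -val_eqE /= eqseq_cons.
  by rewrite (negbTE ii).
by rewrite nested_sum0 // gt_eqF.
Qed.

(** Hölder's inequality, from the weighted mean inequality at each index: the
    missing weight is given to the constant vector [1/n]. *)
Lemma holder_subprobability (I : finType) n (g : I -> 'I_n -> R) (e : I -> R) :
  (forall k i, 0 <= g k i) -> (forall k, \sum_i g k i <= 1) ->
  (forall k, 0 <= e k) -> \sum_k e k <= 1 -> (0 < n)%N ->
  \sum_i \prod_k g k i `^ e k <= n%:R `^ (1 - \sum_k e k).
Proof.
move=> g0 g1 e0 e1 n0; set x := 1 - _.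
have np : (0 : R) < n%:R by rewrite ltr0n.
have x0 : 0 <= x by rewrite subr_ge0.
have px : 0 < n%:R `^ x by exact: powR_gt0.
have h i : n%:R `^ (- x) * \prod_k g k i `^ e k <=
    \sum_k e k * g k i + x * n%:R^-1.
  pose e' (k : I + 'I_1) := if k is inl k then e k else x.
  pose u (k : I + 'I_1) := if k is inl k then g k i else n%:R^-1.
  have := @weighted_amgm R _ e' u.
  have -> : n%:R `^ (- x) = n%:R^-1 `^ x.
    by rewrite -mulN1r powRrM powR_inv1 // ltW.
  rewrite !big_sumType /= !big_ord1 [leLHS]mulrC; apply; first by case.
    by rewrite /x subrKC.
  by case=> [k|k] //=; rewrite invr_ge0 ltW.
rewrite -(ler_pM2l (_ : 0 < n%:R `^ (- x))) ?powR_gt0 //.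
rewrite -powRD ?(gt_eqF np) ?implybT // addNr powRr0 mulr_sumr.
apply: le_trans (ler_sum _ (fun i _ => h i)) _.
rewrite big_split /= exchange_big /= sumr_const card_ord -mulrnAr -mulr_natr.
rewrite mulVf ?gt_eqF // mulr1 -[leRHS](subrKC (\sum_k e k)) lerD2r.
apply: ler_sum => k _; rewrite -mulr_sumr ler_piMr //.
Qed.

(** Exponential growth beats polynomial growth; the polynomial factor makes
    room for the logarithmic losses of the random forms. *)
Lemma growth_exponent (x y C : R) (d : nat) :
  (forall l : nat, (2 ^ l)%:R `^ x <= C * l.+1%:R ^+ d * (2 ^ l)%:R `^ y) ->
  x <= y.
Proof.
move=> h; rewrite leNgt; apply/negP => yx.
have l2 : 0 < ln (2 : R) by rewrite ln_gt0 // ltr1n.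
pose u := ln 2 * (x - y) / d.+1%:R.
have u0 : 0 < u by rewrite divr_gt0 ?ltr0n // mulr_gt0 // subr_gt0.
pose v := Num.min 1 u; have v0 : 0 < v by rewrite lt_min ltr01.
have lin (l : nat) : v ^+ d.+1 * l.+1%:R <= C.
  have N0 : (0 : R) < (2 ^ l)%:R by rewrite ltr0n expn_gt0.
  have l0 : (0 : R) < l.+1%:R by rewrite ltr0n.
  have e1 : (2 ^ l)%:R `^ x = (2 ^ l)%:R `^ y * expR (l%:R * u) ^+ d.+1.
    rewrite -[in LHS](subrKC y x) powRD ?(gt_eqF N0) ?implybT //; congr (_ * _).
    rewrite -expRM_natl {1}/powR gt_eqF // natrX lnXn ?ltr0n //; congr expR.
    by rewrite -[ln 2 *+ l]mulr_natl /u;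
      move: (d.+1%:R : R) (gt_eqF (ltr0Sn R d)) => D D0; field; rewrite D0.
  have := h l; rewrite e1 mulrC ler_pM2r ?powR_gt0 // => h'.
  rewrite -(@ler_pM2r _ (l.+1%:R ^+ d)) ?exprn_gt0 // -mulrA -exprS.
  rewrite -exprMn; apply: le_trans h'.
  rewrite ler_pXn2r ?nnegrE ?expR_ge0 ?mulr_ge0 ?(ltW v0) //.
  apply: le_trans (expR_ge1Dx _).
  rewrite -natr1 mulrDr mulr1 addrC lerD //; first by rewrite ge_min lexx.
  by rewrite mulrC ler_wpM2l // ge_min lexx orbT.
have vp : 0 < v ^+ d.+1 by rewrite exprn_gt0.
have := lin (Num.bound (`|C| / v ^+ d.+1)).
rewrite leNgt => /negP; apply.
have := @archi_boundP R (`|C| / v ^+ d.+1); rewrite divr_ge0 ?(ltW vp) // => /(_ isT).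
rewrite ltr_pdivrMr // mulrC => /(le_lt_trans (ler_norm C)) /lt_trans; apply.
by rewrite ltr_pM2l // ltr_nat.
Qed.

(** Tested on the form [\sum_i z_1(i) * z_2(i) * ...], whose norm is at most
    [n `^ (1 - 1/p_1 - 1/p_2 - ...)] by Hölder and whose mixed norm is
    [n `^ (1/t_1)], since the first index determines the others. *)
Lemma first_exponent_necessary m (r t : 'I_m.+1 -> R) :
  (forall k, 0 <= r k) -> tail r 0 <= 1 -> tensor_admissible s r t ->
  (t ord0)^-1 <= 1 - tail r 0.
Proof.
move=> r0 r1 [t0 [C h]].
apply: (@growth_exponent _ _ C 0) => l; rewrite expr0 mulr1.
have n0 : (0 < 2 ^ l)%N by rewrite expn_gt0.
move: (2 ^ l)%N n0 => n n0.
pose a (j : m.+1.-tuple 'I_n) : K :=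
  (behead_tuple j == [tuple of nseq m (tnth j ord0)])%:R.
have aE i j : a (cons_tuple i j) = (j == [tuple of nseq m i])%:R.
  by rewrite /a tnth_cons0; congr (_ == _)%:R; exact: val_inj.
have ab : bounded_by r a (n%:R `^ (1 - tail r 0)).
  move=> z zb; have [g gP] := choice zb.
  have -> : eval a z = \sum_i \prod_k z k i.
    rewrite eval_cons; apply: eq_bigr => i _; rewrite big_ord_recl; congr (_ * _).
    rewrite /eval (bigD1 [tuple of nseq m i]) //= aE eqxx mul1r.
    rewrite [X in _ + X]big1 ?addr0 => [|j ji]; last by rewrite aE (negbTE ji) mul0r.
    by apply: eq_bigr => k _; rewrite tnth_nseq.
  apply: le_trans (modulus_sum _ _ _) _; rewrite tail0.
  apply: (@le_trans _ _ (\sum_i \prod_k g k i `^ r k)).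
    apply: ler_sum => i _; rewrite modulus_prod; apply: ler_prod => k _.
    by rewrite modulus_ge0; case: (gP k) => _ _ ->.
  have r1' : \sum_k r k <= 1 by rewrite -tail0.
  apply: holder_subprobability => //.
    by move=> k i; case: (gP k).
  by move=> k; case: (gP k).
have := h n a _ n0 ab; congr (_ <= _); rewrite /tensor_norm /= div1r.
congr (_ `^ _); rewrite (eq_bigr (fun=> 1)) ?sumr_const ?card_ord // => i _.
rewrite -[RHS](@nested_sum_delta _ n (t ord0) (behead_fun t) [tuple of nseq m i]) ?gt_eqF //.
  congr (nested_sum _ _ _); apply/funext => j; rewrite aE.
  by case: (_ == _); rewrite ?modulus1 ?modulus0.
by move=> k; exact: t0.
Qed.

Lemma exponent_necessary m (r t : 'I_m -> R) (k : 'I_m) :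
  (forall k, 0 <= r k) -> tail r k <= 1 -> tensor_admissible s r t ->
  (t k)^-1 <= 1 - tail r k.
Proof.
elim: m r t k => [|m IH] r t k r0 rk adm; first by case: k rk.
case: (unliftP ord0 k) rk => [k'|] -> rk; last exact: first_exponent_necessary.
have e : tail r (lift ord0 k') = tail (behead_fun r) k' by rewrite -tail_behead.
rewrite e; apply: (IH _ (behead_fun t)); rewrite -?e //.
  by move=> i; exact: r0.
exact: admissible_behead.
Qed.

End DiagonalForms.

(** * Lower bounds from random sign tensors *)

Section RandomSigns.
Variable R : realType.

(** The factor [2], in place of the sharp [1/2], makes [expR (- x) <= 1 / (1 + x)]
    enough for small [x], and [expR `|x|] enough otherwise. *)
Lemma cosh_le (x : R) : (expR x + expR (- x)) / 2 <= expR (2 * x ^+ 2).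
Proof.
have h1 (y : R) : 0 < 1 + y -> expR (- y) <= (1 + y)^-1.
  by move=> y1; rewrite expRN lef_pV2 ?posrE ?expR_gt0 // expR_ge1Dx.
case: (leP (2 * x ^+ 2) 1) => hx.
  have xlt : 0 < 1 - x ^+ 2 by move: hx; lra.
  have [x1 x2] : 0 < 1 + x /\ 0 < 1 - x.
    by split; nra.
  have := h1 x x1; have := h1 (- x) x2; rewrite opprK => a1 a2.
  apply: (@le_trans _ _ (1 + 2 * x ^+ 2)); last exact: expR_ge1Dx.
  apply: (@le_trans _ _ ((1 - x ^+ 2)^-1)).
    have -> : (1 - x ^+ 2)^-1 = ((1 - x)^-1 + (1 + x)^-1) / 2.
      by field; rewrite !gt_eqF // subr_sqr_1 mulr_gt0 // addrC.
    by rewrite ler_pM2r ?invr_gt0 // lerD.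
  rewrite -[leLHS]div1r ler_pdivrMr //.
  by move: hx (sqr_ge0 x); set y := x ^+ 2 => ? ?; nra.
have xa : `|x| <= 2 * x ^+ 2.
  rewrite -[x ^+ 2]real_normK ?num_real // in hx *.
  have := normr_ge0 x; nra.
have [e1 e2] : expR x <= expR (2 * x ^+ 2) /\ expR (- x) <= expR (2 * x ^+ 2).
  rewrite !ler_expR; split; first exact: le_trans (ler_norm x) xa.
  by apply: le_trans xa; rewrite -normrN ler_norm.
lra.
Qed.

(** The signs are independent, so that the exponential moment factors into
    hyperbolic cosines. *)
Lemma avg_exp_signs (J : finType) (c : J -> R) :
  avg (fun f : {ffun J -> bool} => expR (\sum_j (-1) ^+ f j * c j)) <=
    expR (2 * \sum_j c j ^+ 2).
Proof.
have -> : avg (fun f : {ffun J -> bool} => expR (\sum_j (-1) ^+ f j * c j)) =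
    \prod_j ((expR (c j) + expR (- c j)) / 2).
  rewrite /avg (eq_bigr (fun f : {ffun J -> bool} =>
    \prod_j expR ((-1) ^+ f j * c j))) => [|f _]; last by rewrite expR_sum.
  rewrite -(bigA_distr_bigA (fun j (b : bool) => expR ((-1) ^+ b * c j))).
  rewrite card_ffun card_bool natrX big_split /= prodr_const exprVn mulrC.
  congr (_ * _); apply: eq_bigr => j _.
  by rewrite big_bool expr1 expr0 mulN1r mul1r addrC.
rewrite mulr_sumr expR_sum; apply: ler_prod => j _.
by rewrite cosh_le divr_ge0 ?addr_ge0 ?expR_ge0.
Qed.

(** The entries [0], [1] and [-1], indexed by a finite type for the union bound. *)
Definition trit (v : option bool) : R := if v is Some b then (-1) ^+ b else 0.

Lemma trit_sqr v : trit v ^+ 2 = (v != None)%:R.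
Proof. by case: v => [b|] /=; rewrite ?expr0n // sqrr_sign. Qed.

Lemma prod_sum_tuple m n (F : 'I_m -> 'I_n -> R) :
  \sum_(j : m.-tuple 'I_n) \prod_k F k (tnth j k) = \prod_k \sum_i F k i.
Proof.
elim: m F => [|m IH] F; first by rewrite sum_tuple0 !big_ord0.
rewrite sum_tuple_cons big_ord_recl -IH mulr_suml; apply: eq_bigr => i _.
rewrite mulr_sumr; apply: eq_bigr => j _; rewrite big_ord_recl tnth_cons0.
by congr (_ * _); apply: eq_bigr => k _; rewrite tnth_consS.
Qed.

(** The squared [l_2] norm of the elementary tensor with these entries. *)
Definition flat_mass m n (v : 'I_m -> 'I_n -> option bool) : R :=
  \prod_k \sum_i (v k i != None)%:R.

Lemma flat_mass_ge0 m n (v : 'I_m -> 'I_n -> option bool) : 0 <= flat_mass v.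
Proof. by apply: prodr_ge0 => k _; apply: sumr_ge0 => i _; rewrite ler0n. Qed.

(** Union bound over the [3 ^ (m n)] vectors with entries in [{-1, 0, 1}]: some
    sign tensor is simultaneously small on all of them. The two signs of the
    sum are handled by one extra boolean, and [x] is the optimal parameter of
    the exponential moment. *)
Lemma exists_small_signs m n : (0 < n)%N ->
  exists f : {ffun m.-tuple 'I_n -> bool}, forall v : 'I_m -> 'I_n -> option bool,
    `|\sum_j (-1) ^+ f j * \prod_k trit (v k (tnth j k))| <=
      (2 * m + 3)%:R * Num.sqrt (n%:R * flat_mass v).
Proof.
move=> n0; have np : (0 : R) < n%:R by rewrite ltr0n.
pose V := {ffun 'I_m -> {ffun 'I_n -> option bool}}.
pose X (v : 'I_m -> 'I_n -> option bool) (f : {ffun m.-tuple 'I_n -> bool}) : R :=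
  \sum_j (-1) ^+ f j * \prod_k trit (v k (tnth j k)).
pose F (w : V) k i := w k i.
pose x v := Num.sqrt (n%:R / @flat_mass m n v).
have mass v : \sum_(j : m.-tuple 'I_n) (\prod_k trit (v k (tnth j k))) ^+ 2 = flat_mass v.
  rewrite /flat_mass -prod_sum_tuple; apply: eq_bigr => j _; rewrite -prodrXl.
  by apply: eq_bigr => k _; rewrite trit_sqr.
have moment (b : bool) v :
    avg (fun f => expR ((-1) ^+ b * x v * X v f - 2 * (x v ^+ 2 * flat_mass v))) <= 1.
  have -> : avg (fun f => expR ((-1) ^+ b * x v * X v f - 2 * (x v ^+ 2 * flat_mass v))) =
      expR (- (2 * (x v ^+ 2 * flat_mass v))) *
      avg (fun f : {ffun m.-tuple 'I_n -> bool} => expR (\sum_j (-1) ^+ f j *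
        ((-1) ^+ b * x v * \prod_k trit (v k (tnth j k))))).
    rewrite -avgZ; apply: eq_avg => f; rewrite addrC expRD; congr (_ * expR _).
    by rewrite mulr_sumr; apply: eq_bigr => j _; rewrite mulrCA.
  have e1 : 1 = expR (- (2 * (x v ^+ 2 * flat_mass v))) *
      expR (2 * (x v ^+ 2 * flat_mass v)) by rewrite -expRD addNr expR0.
  rewrite [leRHS]e1.
  rewrite ler_pM2l ?expR_gt0 //.
  apply: le_trans (avg_exp_signs _) _; rewrite ler_expR ler_wpM2l //.
  rewrite -mass mulr_sumr; apply: ler_sum => j _.
  by rewrite !exprMn sqrr_sign mul1r.
have [f fP] : exists f, \sum_(w : bool * V)
    expR ((-1) ^+ w.1 * x (F w.2) * X (F w.2) f -
      2 * (x (F w.2) ^+ 2 * flat_mass (F w.2))) <=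
    #|{: bool * V}|%:R.
  apply: ex_ge_avg; first by rewrite card_ffun card_bool expn_gt0.
  rewrite avg_sum -sum1_card natr_sum; apply: ler_sum => w _; exact: moment.
have cardW : #|{: bool * V}|%:R <= expR ((2 * m + 1)%:R * n%:R) :> R.
  rewrite card_prod card_bool card_ffun card_ord card_ffun card_ord.
  rewrite card_option card_bool natrM !natrX.
  have -> : (2 * m + 1)%:R * n%:R = n%:R + m%:R * (n%:R * 2) :> R by ring.
  rewrite expRD ler_pM ?exprn_ge0 //.
    apply: le_trans (expR_ge1Dx _); rewrite -[leLHS]/(1 + 1) lerD2l.
    by rewrite ler1n.
  rewrite expRM_natl lerXn2r ?nnegrE ?expR_ge0 ?exprn_ge0 //.
  rewrite expRM_natl lerXn2r ?nnegrE ?expR_ge0 //.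
  by apply: le_trans (expR_ge1Dx _); rewrite -[1]/(1%:R) -natrD.
exists f => v; rewrite -/(X v f).
have [m0|m0] := eqVneq (flat_mass v) 0.
  have : \sum_j (\prod_k trit (v k (tnth j k))) ^+ 2 = 0 :> R by rewrite mass.
  move/sum_sqr_eq0 => z; rewrite /X big1 ?normr0 ?mulr_ge0 ?sqrtr_ge0 //.
  by move=> j _; rewrite z mulr0.
have mp : 0 < flat_mass v by rewrite lt_def m0 flat_mass_ge0.
have xp : 0 < x v by rewrite sqrtr_gt0 divr_gt0.
have x2 : x v ^+ 2 * flat_mass v = n%:R.
  by rewrite sqr_sqrtr ?divfK // divr_ge0 ?ltW.
have xs : x v * Num.sqrt (n%:R * flat_mass v) = n%:R.
  rewrite -sqrtrM ?divr_ge0 ?(ltW np) ?(ltW mp) // mulrACA mulVf // mulr1.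
  by rewrite -expr2 sqrtr_sqr gtr0_norm.
pose v' : V := [ffun k => [ffun i => v k i]].
have vv : F v' = v.
  by apply/funext => k; apply/funext => i; rewrite /F !ffunE.
(* The two signs give both halves of the bound on the absolute value. *)
have key (b : bool) : (-1) ^+ b * x v * X v f <= (2 * m + 3)%:R * n%:R.
  have : expR ((-1) ^+ b * x v * X v f - 2 * (x v ^+ 2 * flat_mass v)) <=
      expR ((2 * m + 1)%:R * n%:R).
    apply: le_trans cardW; apply: le_trans fP.
    rewrite (bigD1 (b, v')) //= vv lerDl sumr_ge0 // => w _; exact: expR_ge0.
  rewrite ler_expR x2 lerBlDr => /le_trans; apply.
  by rewrite -mulrDl -natrD -addnA.
have := key false; have := key true; rewrite expr0 expr1 mul1r => k1 k2.
have : x v * `|X v f| <= (2 * m + 3)%:R * n%:R.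
  rewrite -[x v in X in X <= _]gtr0_norm // -normrM ler_norml k2 andbT lerNl.
  by apply: le_trans k1; rewrite mulN1r mulNr.
by move=> hX; rewrite -(ler_pM2l xp) mulrCA xs.
Qed.

Definition harmonic n : R := \sum_(i < n) i.+1%:R^-1.

Lemma harmonic_ge0 n : 0 <= harmonic n.
Proof. by apply: sumr_ge0 => i _; rewrite invr_ge0. Qed.

Lemma harmonic_pow2 l : harmonic (2 ^ l) <= l.+1%:R.
Proof.
elim: l => [|l IH]; first by rewrite /harmonic expn0 big_ord1 invr1.
rewrite expnS mul2n -addnn /harmonic big_split_ord /= -natr1 lerD //.
apply: (@le_trans _ _ (\sum_(i < 2 ^ l) ((2 ^ l)%:R)^-1)).
  apply: ler_sum => i _; rewrite lef_pV2 ?posrE ?ltr0n ?expn_gt0 //.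
  by rewrite ler_nat -addnS leq_addr.
by rewrite sumr_const card_ord -[_ *+ (2 ^ l)]mulr_natl mulfV // pnatr_eq0 -lt0n expn_gt0.
Qed.

(** A nonnegative vector whose sum over every set [S] is at most
    [B * sqrt #|S|] is in weak [l_2]: its smallest entry on [S] is at most
    [B / sqrt #|S|]. Removing the smallest entries one after the other bounds
    its [l_2] norm up to a logarithm. *)
Lemma weak_l2 (I : finType) (u : I -> R) (B : R) : (forall i, 0 <= u i) ->
  (forall S : {set I}, \sum_(i in S) u i <= B * Num.sqrt #|S|%:R) ->
  forall S : {set I}, \sum_(i in S) u i ^+ 2 <= B ^+ 2 * harmonic #|S|.
Proof.
move=> u0 h S; move Ek : #|S| => k; elim: k S Ek => [|k IH] S Sk.
  by rewrite (cards0_eq Sk) big_set0 /harmonic big_ord0 mulr0.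
have /card_gt0P[i0 i0S] : (0 < #|S|)%N by rewrite Sk.
pose i := [arg min_(i < i0 in S) u i]%O.
have [iS imin] : i \in S /\ forall l, l \in S -> u i <= u l.
  by rewrite /i; case: arg_minP => // l lS h'; split.
rewrite (big_setD1 i iS) /= /harmonic big_ord_recr /= mulrDr addrC.
apply: lerD; first by apply: IH; move: Sk; rewrite (cardsD1 i) iS => -[].
have kp : (0 : R) < k.+1%:R by rewrite ltr0n.
have hs : k.+1%:R * u i <= B * Num.sqrt k.+1%:R.
  rewrite -Sk; apply: le_trans (h S).
  rewrite mulr_natl -sumr_const; exact: ler_sum.
rewrite ler_pdivlMr // -(ler_pM2l kp).
have := @lerXn2r R 2 _ _ _ _ hs; rewrite !nnegrE !exprMn (sqr_sqrtr (ltW kp)) => h2.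
have : k.+1%:R ^+ 2 * u i ^+ 2 <= B ^+ 2 * k.+1%:R.
  apply: h2; first by rewrite mulr_ge0 // ltW.
  by apply: le_trans hs; rewrite mulr_ge0 // ltW.
rewrite [leRHS]mulrC; congr (_ <= _); ring.
Qed.

End RandomSigns.

Section RandomForms.
Variables (R : realType) (s : scalar_kind).
Notation K := (scalars R s).

Lemma coord_real b (x : R) (y : K) : coord b (real_scalar s x * y) = x * coord b y.
Proof.
rewrite /coord /real_scalar; case: s y => /= y; first by case: b; rewrite ?mulr0.
by case: y => u v; case: b => /=; rewrite mul0r ?subr0 ?addr0.
Qed.

(** Choosing the signs of the real, then of the imaginary parts puts both in weak
    [l_2]. *)
Lemma l2_of_flat n (phi : 'I_n -> K) (B : R) :
  (forall v : 'I_n -> option bool,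
    modulus (\sum_i real_scalar s (trit R (v i)) * phi i) <=
      B * Num.sqrt (\sum_i (v i != None)%:R)) ->
  \sum_i modulus (phi i) ^+ 2 <= 2 * (B ^+ 2 * harmonic R n).
Proof.
move=> h; rewrite (eq_bigr _ (fun i _ => modulus_sq (phi i))) exchange_big /=.
have -> : 2 * (B ^+ 2 * harmonic R n) = \sum_(b : bool) B ^+ 2 * harmonic R n.
  by rewrite sumr_const card_bool mulr_natl.
apply: ler_sum => b _.
have := @weak_l2 R _ (fun i => `|coord b (phi i)|) B _ _ [set: 'I_n].
rewrite cardsT card_ord => hw.
have -> : \sum_i coord b (phi i) ^+ 2 =
    \sum_(i in [set: 'I_n]) `|coord b (phi i)| ^+ 2.
  rewrite [RHS](eq_bigl xpredT) => [|i]; last by rewrite inE.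
  by apply: eq_bigr => i _; rewrite real_normK ?num_real.
apply: hw => // S.
pose v i := if i \in S then Some (coord b (phi i) < 0) else None.
have -> : \sum_(i in S) `|coord b (phi i)| =
    coord b (\sum_i real_scalar s (trit R (v i)) * phi i).
  rewrite coord_sum big_mkcond; apply: eq_bigr => i _; rewrite coord_real /v.
  by case: ifP => _ /=; rewrite ?mul0r // [LHS]normrEsign.
apply: le_trans (ler_norm _) _; apply: le_trans (coord_le_modulus _ _) _.
apply: le_trans (h v) _; rewrite le_eqVlt; apply/orP; left; apply/eqP.
congr (_ * Num.sqrt _); rewrite -sum1_card natr_sum [RHS]big_mkcond.
by apply: eq_bigr => i _; rewrite /v; case: ifP.
Qed.

Lemma flat_mass_fcons m n (x : 'I_n -> option bool) (v : 'I_m -> 'I_n -> option bool) :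
  flat_mass R (fcons x v) = (\sum_i (x i != None)%:R) * flat_mass R v.
Proof.
rewrite /flat_mass big_ord_recl fcons0; congr (_ * _).
by apply: eq_bigr => k _; rewrite fconsS.
Qed.

(** From vectors with entries in [{-1, 0, 1}] to arbitrary vectors, one
    variable at a time and at the cost of a logarithm for each. *)
Lemma flat_to_l2 m n (a : m.-tuple 'I_n -> K) (B : R) : 0 <= B ->
  (forall v : 'I_m -> 'I_n -> option bool,
    modulus (eval a (fun k i => real_scalar s (trit R (v k i)))) <=
      B * Num.sqrt (flat_mass R v)) ->
  forall z, modulus (eval a z) <=
    B * Num.sqrt (2 * harmonic R n) ^+ m *
    \prod_k Num.sqrt (\sum_i modulus (z k i) ^+ 2).
Proof.
elim: m a B => [|m IH] a B B0 h z.
  have := h (fun _ _ => None); rewrite /flat_mass !big_ord0 sqrtr1 expr0 !mulr1.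
  by rewrite /eval !sum_tuple0 !big_ord0.
pose z' k := z (lift ord0 k); pose phi i := eval (fun j => a (cons_tuple i j)) z'.
set H := Num.sqrt (2 * _).
have H0 : 0 <= H by exact: sqrtr_ge0.
set P := \prod_k Num.sqrt (\sum_i modulus (z' k i) ^+ 2).
have P0 : 0 <= P by apply: prodr_ge0 => k _; exact: sqrtr_ge0.
rewrite eval_cons -/z' big_ord_recl -/P.
have hphi : \sum_i modulus (phi i) ^+ 2 <= (B * H ^+ m.+1 * P) ^+ 2.
  apply: le_trans (@l2_of_flat _ phi (B * H ^+ m * P) _) _ => [v|].
    have := IH (fun j => \sum_i real_scalar s (trit R (v i)) * a (cons_tuple i j))
      (B * Num.sqrt (\sum_i (v i != None)%:R))
      (mulr_ge0 B0 (sqrtr_ge0 _)) _ z'.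
    set x := fun i => real_scalar s (trit R (v i)).
    have -> : eval (fun j => \sum_i x i * a (cons_tuple i j)) z' = \sum_i x i * phi i.
      have := eval_contract a (fcons x z'); rewrite eval_cons fcons0.
      have -> : (fun k => fcons x z' (lift ord0 k)) = z'.
        by apply/funext => k; rewrite fconsS.
      by move=> <-.
    move=> /(_ _)/le_trans; apply; last first.
      by rewrite le_eqVlt; apply/orP; left; apply/eqP; rewrite -/H -/P; ring.
    move=> w; have := h (fcons v w); rewrite eval_contract flat_mass_fcons.
    rewrite fcons0 sqrtrM; last by apply: sumr_ge0 => i _; rewrite ler0n.
    rewrite mulrA; congr (modulus (eval _ _) <= _).
    by apply/funext => k; rewrite fconsS.
  rewrite le_eqVlt; apply/orP; left; apply/eqP.
  have HE : H ^+ 2 = 2 * harmonic R n.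
    by rewrite sqr_sqrtr // mulr_ge0 // harmonic_ge0.
  transitivity ((B * H ^+ m * P) ^+ 2 * (2 * harmonic R n)); first by ring.
  by rewrite -HE [H ^+ m.+1]exprS; ring.
apply: le_trans (modulus_sum _ _ _) _.
under eq_bigr => i _ do rewrite modulusM -/(phi i).
apply: (@le_trans _ _ (Num.sqrt (\sum_i modulus (z ord0 i) ^+ 2) * (B * H ^+ m.+1 * P))).
  rewrite -(@ler_pXn2r _ 2) ?nnegrE //; first 1 last.
  - by apply: sumr_ge0 => i _; rewrite mulr_ge0 ?modulus_ge0.
  - by rewrite !mulr_ge0 ?sqrtr_ge0 ?exprn_ge0.
  apply: le_trans (cauchy_schwarz _ _) _.
  rewrite exprMn sqr_sqrtr ?ler_wpM2l ?sumr_ge0 // => i _; exact: sqr_ge0.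
by rewrite le_eqVlt; apply/orP; left; apply/eqP; ring.
Qed.

Lemma nested_sum_ones m n x (t : 'I_m -> R) : (forall k, 0 < t k) ->
  nested_sum x t (fun _ : m.-tuple 'I_n => 1) = n%:R `^ (x * \sum_k (t k)^-1).
Proof.
elim: m x t => [|m IH] x t t0 /=; first by rewrite big_ord0 mulr0 powRr0 powR1.
rewrite (eq_bigr _ (fun i _ => IH _ _ (fun k => t0 (lift ord0 k)))).
rewrite sumr_const card_ord big_ord_recl.
set y := \sum_(k < m) _; have [->|n0] := posnP n.
  rewrite mulr0n.
  have t1 : 0 < (t ord0)^-1 by rewrite invr_gt0.
  have y0 : 0 <= y by apply: sumr_ge0 => k _; rewrite invr_ge0 ltW.
  have [->|x0] := eqVneq x 0; first by rewrite !mul0r !powRr0.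
  by rewrite !powR0 // mulf_neq0 // gt_eqF // ltr_wpDr.
have np : (0 : R) < n%:R by rewrite ltr0n.
rewrite -[_ `^ _ *+ n]mulr_natl -[X in X * _]powRr1 // -powRD ?(gt_eqF np) ?implybT // -powRrM.
by congr (_ `^ _); field; rewrite gt_eqF.
Qed.

(** When all [p_k >= 2], a random sign tensor has norm
    [n `^ (1/2 + \sum_k (1/2 - 1/p_k))] up to logarithms. *)
Lemma sum_exponents_necessary m (r t : 'I_m -> R) :
  (forall k, 0 <= r k <= 2^-1) -> tensor_admissible s r t ->
  \sum_k (t k)^-1 <= 2^-1 + \sum_k (2^-1 - r k).
Proof.
move=> rb [t0 [C h]].
apply: (@growth_exponent _ _ _ (`|C| * (2 * m + 3)%:R * 2 ^+ m) m) => l.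
have n0 : (0 < 2 ^ l)%N by rewrite expn_gt0.
have Hl := harmonic_pow2 R l; move: (2 ^ l)%N n0 Hl => n n0 Hl.
have np : (0 : R) < n%:R by rewrite ltr0n.
have [f fP] := exists_small_signs R m n0.
pose a j : K := (-1) ^+ f j.
pose y : R := 2^-1 + \sum_k (2^-1 - r k).
have realsign (b : bool) : (-1) ^+ b = real_scalar s ((-1) ^+ b).
  case: b; rewrite ?expr0 ?real_scalar1 // !expr1; apply/eqP.
  by rewrite -subr_eq0 -opprD oppr_eq0 -real_scalar1 -real_scalarD subrr real_scalar0.
have ab : bounded_by r a ((2 * m + 3)%:R * (2 * l.+1%:R) ^+ m * n%:R `^ y).
  move=> z zb; have [g gP] := choice zb.
  have flat v : modulus (eval a (fun k i => real_scalar s (trit R (v k i)))) <=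
      (2 * m + 3)%:R * Num.sqrt n%:R * Num.sqrt (flat_mass R v).
    rewrite -mulrA -sqrtrM ?(ltW np) //.
    have -> : eval a (fun k i => real_scalar s (trit R (v k i))) =
        real_scalar s (\sum_j (-1) ^+ f j * \prod_k trit R (v k (tnth j k))).
      rewrite real_scalar_sum; apply: eq_bigr => j _; rewrite real_scalarM -realsign.
      congr (_ * _); apply: esym.
      exact: (big_morph _ (@real_scalarM R s) (real_scalar1 R s)).
    by rewrite modulus_real; exact: fP.
  have B0 : 0 <= (2 * m + 3)%:R * Num.sqrt n%:R :> R by rewrite mulr_ge0 ?sqrtr_ge0.
  apply: le_trans (flat_to_l2 B0 flat z) _.
  have -> : n%:R `^ y = Num.sqrt n%:R * \prod_k n%:R `^ (2^-1 - r k).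
    rewrite /y powRD ?(gt_eqF np) ?implybT // powR12_sqrt ?(ltW np) //.
    by rewrite prod_powR.
  have -> : forall u v w x : R, u * v * (w * x) = u * w * v * x by move=> *; ring.
  apply: ler_pM.
  - by rewrite !mulr_ge0 ?exprn_ge0 ?sqrtr_ge0.
  - by apply: prodr_ge0 => k _; exact: sqrtr_ge0.
  - rewrite ler_wpM2l ?mulr_ge0 ?sqrtr_ge0 // lerXn2r ?nnegrE ?sqrtr_ge0 ?mulr_ge0 //.
    have h1 : 1 <= 2 * l.+1%:R :> R by rewrite -natrM ler1n.
    have h2 : 2 * harmonic R n <= 2 * l.+1%:R by rewrite ler_wpM2l.
    have h0 : 0 <= 2 * l.+1%:R :> R by apply: le_trans h1.
    rewrite -[leRHS]ger0_norm // -sqrtr_sqr ler_sqrt ?sqr_ge0 //.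
    by apply: le_trans h2 _; rewrite expr2 ler_peMl.
  - apply: ler_prod => k _; rewrite sqrtr_ge0 /=.
    have [g0 g1 gz] := gP k; have /andP[r0 r1] := rb k.
    have -> : n%:R `^ (2^-1 - r k) = Num.sqrt (n%:R `^ (1 - 2 * r k)).
      by rewrite -powR12_sqrt ?powR_ge0 // -powRrM; congr (_ `^ _); field.
    rewrite ler_sqrt ?powR_ge0 //.
    apply: (@le_trans _ _ (\sum_i g k i `^ (2 * r k))).
      apply: ler_sum => i _; rewrite mulrC powRrM powR_mulrn ?powR_ge0 //.
      by rewrite lerXn2r ?nnegrE ?modulus_ge0 ?powR_ge0.
    have e1 : \sum_(i < 1) 2 * r k = 2 * r k by rewrite big_ord1.
    have e2 : \sum_i \prod_(l < 1) g k i `^ (2 * r k) = \sum_i g k i `^ (2 * r k).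
      by apply: eq_bigr => i _; rewrite big_ord1.
    have := @holder_subprobability R 'I_1 n (fun=> g k) (fun=> 2 * r k).
    rewrite e1 e2 => hh.
    apply: hh => // [_|]; first by rewrite mulr_ge0.
    by rewrite -(ler_pM2l (_ : 0 < 2^-1 :> R)) ?invr_gt0 // mulr1 mulKf.
have := h n a _ n0 ab.
have -> : tensor_norm t a = n%:R `^ (\sum_k (t k)^-1).
  rewrite -[\sum_k _]mul1r -(@nested_sum_ones m n 1 t t0); congr (nested_sum _ _ _).
  by apply/funext => j; rewrite /a -[_ ^+ _]mulr1 modulus_sign modulus1.
move=> /le_trans; apply; rewrite -/y.
apply: (@le_trans _ _ (`|C| * ((2 * m + 3)%:R * (2 * l.+1%:R) ^+ m * n%:R `^ y))).
  by rewrite ler_wpM2r ?ler_norm // !mulr_ge0 ?exprn_ge0 ?powR_ge0 ?mulr_ge0.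
by rewrite le_eqVlt; apply/orP; left; apply/eqP; rewrite exprMn; ring.
Qed.

Lemma tail_exponents_necessary m (r t : 'I_m -> R) (k : nat) :
  (forall i, 0 <= r i) -> (forall i : 'I_m, (k <= i)%N -> r i <= 2^-1) ->
  tensor_admissible s r t ->
  tail (fun i => (t i)^-1) k <= 2^-1 + tail (fun i => 2^-1 - r i) k.
Proof.
elim: k m r t => [|k IH] m r t r0 rk adm.
  rewrite !tail0; apply: sum_exponents_necessary => // i.
  by rewrite r0 rk.
case: m r t r0 rk adm => [|m] r t r0 rk adm.
  by rewrite /tail !big_ord0 addr0 invr_ge0.
rewrite !tail_behead; apply: (IH m (behead_fun r) (behead_fun t)).
- by move=> i; exact: r0.
- by move=> i ki; apply: rk.
- exact: admissible_behead.
Qed.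

End RandomForms.

Section LastLargeTail.
Variable R : realType.

(** The tails are nonincreasing, so that the large ones form an initial segment. *)
Lemma le_k0 m (p : 'I_m -> \bar R) (k : 'I_m) : (forall k, (1 <= p k)%E) ->
  2^-1 <= tail (recip p) 0 ->
  (k <= k0 p)%N = (2^-1 <= tail (recip p) k).
Proof.
move=> p1 h0; apply/idP/idP => [kk|hk]; last exact: (leq_bigmax_cond k hk).
case: m p k p1 h0 kk => [|m] p k p1 h0 kk; first by case: k kk.
have c0 : (0 < #|[pred t : 'I_m.+1 | (2^-1 <= inv_tail p t)%R]|)%N.
  by apply/card_gt0P; exists ord0; rewrite inE.
have [t tP e] := eq_bigmax_cond (fun t : 'I_m.+1 => t : nat) c0.
apply: le_trans (tP : 2^-1 <= tail (recip p) t) _.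
apply: tail_le; first exact: recip_ge0.
by rewrite -e.
Qed.

Lemma exponentsE m (p : 'I_m -> \bar R) : (forall k, (1 <= p k)%E) ->
  2^-1 <= tail (recip p) 0 -> exponents p = exponent (recip p).
Proof.
by move=> p1 h0; apply/funext => k; rewrite /exponents /exponent -le_k0.
Qed.

End LastLargeTail.

(** * The theorem *)

Theorem theorem1p5 (R : realType) (m : nat) (hm : (2 <= m)%N) :
  exists C : R,
    forall (s : scalar_kind) (p : 'I_m -> \bar R),
      (forall k, (1 <= p k)%E) ->
      2^-1 <= \sum_(k < m) fine (p k)^-1%E ->
      \sum_(k < m) fine (p k)^-1%E < 1 ->
      [/\ forall (n : nat)
            (A : ('I_m -> 'rV[scalars R s]_n) -> scalars R s),
            (0 < n)%N -> multilinear A ->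
            mixed_norm (exponents p) A <= C * form_norm p A,
          forall k : 'I_m, (k <= k0 p)%N -> optimal s p k (exponents p k)
        & (forall k : 'I_m, k = k0 p :> nat -> (2 <= p k)%E) ->
          globally_sharp s p (exponents p)].
Proof.
exists (m%:R * 2 ^+ m) => s p p1; set r := recip p.
rewrite -[\sum_k _]/(\sum_k r k) -tail0 => h0 h1.
have r0 : forall k, 0 <= r k by exact: recip_ge0.
have eE : exponents p = exponent r by exact: exponentsE.
have ineq n (A : ('I_m -> 'rV[scalars R s]_n) -> scalars R s) :
    (0 < n)%N -> multilinear A ->
    mixed_norm (exponents p) A <= m%:R * 2 ^+ m * form_norm p A.
  by move=> _ lA; rewrite eE; apply: exponent_inequality => //; exact: form_norm_bound.
have opt (k : 'I_m) : (k <= k0 p)%N -> optimal s p k (exponents p k).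
  move=> kk t; rewrite admissibleE // => adm; have [t0 _] := adm.
  rewrite /exponents kk -/(tail r k).
  have k1 : tail r k < 1 by apply: le_lt_trans h1; exact: tail_le.
  rewrite -[t k]invrK lef_pV2 ?posrE ?invr_gt0 ?subr_gt0 //.
  exact: exponent_necessary r0 (ltW k1) adm.
split=> // p2; split.
  split=> [k|]; last by exists (m%:R * 2 ^+ m).
  have h01 : 2^-1 <= tail r 0 < 1 by rewrite h0.
  have /andP[h _] := exponent_bounds k r0 h01.
  by rewrite eE; apply: lt_le_trans h.
move=> j eps e0 ej adm.
(* Up to the last large tail, lowering an exponent contradicts its optimality. *)
have [jk|kj] := leqP j (k0 p).
  have := opt j jk _ adm; rewrite dfwithin; lra.
have kap_lt : (k0 p < m)%N by apply: ltn_trans kj (ltn_ord j).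
(* Beyond it, all the [p_i] from position [k0 p] on are at least [2] and the random
   forms in these variables apply; the exponents other than [j] are saturated, so
   that they leave [(2 - eps)^-1 <= 2^-1]. *)
pose kap := Ordinal kap_lt.
have ej2 : exponents p j = 2 by rewrite /exponents leqNgt kj.
have rk (i : 'I_m) : (kap <= i)%N -> r i <= 2^-1.
  rewrite leq_eqVlt => /orP[/eqP ki|ki].
    have /= := p2 i (esym ki); rewrite /r /recip.
    case: (p i) (p1 i) => [x||] //=; rewrite ?lee_fin => x1 x2.
      by rewrite fine_invr lef_pV2 ?posrE // (lt_le_trans _ x2).
  have : ~~ (i <= k0 p)%N by rewrite -ltnNge.
  rewrite le_k0 // -/r -ltNge => /ltW; apply: le_trans.
  by rewrite /tail (bigD1 i) //= lerDl sumr_ge0.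
move: adm; rewrite admissibleE //; set t := dfwith _ _ _ => adm.
have := tail_exponents_necessary r0 rk adm.
have jkap : j != kap by rewrite neq_ltn kj orbT.
have split_tail (F : 'I_m -> R) : tail F kap =
    F kap + (F j + \sum_(i < m | ((k0 p <= i)%N && (i != kap)) && (i != j)) F i).
  rewrite /tail (bigD1 kap) //= (bigD1 (I := 'I_m) j) //=.
  by rewrite jkap (ltnW kj).
rewrite !split_tail.
have -> : t kap = (1 - tail r kap)^-1.
  by rewrite /t dfwithout ?(eq_sym kap) // /exponents leqnn.
have -> : t j = 2 - eps by rewrite /t dfwithin ej2.
rewrite invrK (split_tail r) [X in _ + (_ + X) <= _](eq_bigr (fun=> 2^-1)); last first.
  move=> i /andP[/andP[ki ikap] ij].
  have ki' : (k0 p < i)%N by rewrite ltn_neqAle ki andbT eq_sym; exact: ikap.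
  by rewrite /t dfwithout ?(eq_sym j) // /exponents leqNgt ki'.
rewrite [X in _ <= _ + (_ + (_ + X))]sumrB.
set S1 := \sum_(i < m | _) 2^-1; set S2 := \sum_(i < m | _) r i => hh.
have : (2 - eps)^-1 <= 2^-1 by lra.
by rewrite lef_pV2 ?posrE //; rewrite ?subr_gt0 -?ej2 //; rewrite ej2; lra.
Qed.
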